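(* Let $(M,d)$ be a nonempty compact metric space and $\Phi$ a set-valued dynamical system on $M$. Given a probability measure $\mu\in\mathcal{P}(M)$, the following two statements are equivalent: (i) for any $t\ge0$ there exists a Borel probability measure $\nu_t$ on $S_{\Phi_t}$ such that (1) $\tilde\pi_0^*(\nu_t)=\mu$ and (2) $\nu_t$ is $\tilde\Theta$-invariant; (ii) there exists a Borel probability measure $\nu$ on $S_\Phi$ such that (a) $\pi_0^*(\nu)=\mu$ and (b) $\nu$ is $\Theta$-invariant. Call a measure $\mu$ satisfying these equivalent conditions an invariant measure for $\Phi$, and let $\mathcal{P}_\Phi(M)$ be the set of invariant measures for $\Phi$. Then $\mathcal{P}_\Phi(M)$ is a nonempty compact convex subset of $\mathcal{P}(M)$.
   Context: For nonempty closed sets $A,B$ put $d_H(A,B):=\sup_{a\in A}d(a,B)$; the Hausdorff distance is $\max\{d_H(A,B),d_H(B,A)\}$. A set-valued dynamical system (SVDS) on $M$ is a map $\Phi$ assigning to each $(t,x)\in\mathbb{R}_+\times M$ a nonempty closed set $\Phi_t(x)\subset M$ such that: (a) $\Phi_0(x)=\{x\}$ for all $x$; (b) $\Phi_t(\Phi_s(x))=\Phi_{t+s}(x)$ for all $x$ and $s,t\ge0$, where $\Phi_t(A)=\bigcup_{a\in A}\Phi_t(a)$; (c) for each $x$, $t\mapsto\Phi_t(x)$ is continuous for the Hausdorff distance; (d) for each $t$, $x\mapsto\Phi_t(x)$ is upper semicontinuous: for all $x_0\in M$, $\varepsilon>0$ there is $\delta>0$ with $d_H(\Phi_t(x),\Phi_t(x_0))<\varepsilon$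 for all $x\in B(x_0,\delta)$. An entire solution of $\Phi$ is a function $\mathbf{z}:\mathbb{R}\to M$ with $\mathbf{z}(t)\in\Phi_{t-s}(\mathbf{z}(s))$ for all $s\le t$ in $\mathbb{R}$ (such functions are continuous). $S_\Phi$ is the set of entire solutions, a subset of $\mathcal{C}(\mathbb{R},M)$, which carries the topology of uniform convergence on compact sets. The translation flow is $\Theta_t(\mathbf{y})(s)=\mathbf{y}(t+s)$, $t\in\mathbb{R}$, $\mathbf{y}\in\mathcal{C}(\mathbb{R},M)$, and $\pi_0(\mathbf{y})=\mathbf{y}(0)$. For fixed $t\ge0$, $S_{\Phi_t}:=\{\mathbf{x}\in M^{\mathbb{Z}}:\mathbf{x}_{i+1}\in\Phi_t(\mathbf{x}_i)\ \forall i\in\mathbb{Z}\}$, with $M^{\mathbb{Z}}$ carrying the product topology. The shift is $(\tilde\Theta(\mathbf{x}))_i=\mathbf{x}_{i+1}$, and $\tilde\pi_0(\mathbf{x})=\mathbf{x}_0$. $\mathcal{P}(\cdot)$ denotes the set of Borel probability measures with the weak$^*$ topology; for a Borel map $f$, $f^*(\nu)(A)=\nu(f^{-1}(A))$ is the push-forward. Invariance of a measure under a flow $(\theta_t)$ means $\mu(\theta_t^{-1}(A))=\mu(A)$ for all Borel $A$ and all $t$, and similarly for a single map. Measures on a closed subset are identified with measures on the ambient space supported in it. *)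

(* Defs.v *)
From HB Require Import structures.
From mathcomp Require Import all_boot all_order all_algebra interval_inference.
From mathcomp Require Import all_classical all_reals all_analysis.
Set Implicit Arguments.
Unset Strict Implicit.
Unset Printing Implicit Defensive.
Import Order.TTheory GRing.Theory Num.Theory.
Import numFieldNormedType.Exports.
Local Open Scope classical_set_scope.
Local Open Scope ring_scope.

(* Nonempty metric spaces: measurableType is built on pointed types, so
   nonemptiness is carried by a base point, which plays no other role. *)
#[short(type="pmetricType")]
HB.structure Definition PointedMetric (R : numDomainType) :=
  {M of Metric R M & isPointed M}.

Section hausdorff_distance.
Context {R : realType} {M : metricType R}.
Local Open Scope ereal_scope.
Implicit Types A B : set M.

(* Values in \bar R, so that no boundedness is needed for sup and inf to be
   the intended ones. *)
Definition point_set_dist (a : M) B : \bar R :=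
  ereal_inf [set (mdist a b)%:E | b in B].

Definition semi_hausdorff A B : \bar R :=
  ereal_sup [set point_set_dist a B | a in A].

Definition hausdorff_dist A B : \bar R :=
  maxe (semi_hausdorff A B) (semi_hausdorff B A).

End hausdorff_distance.

(* The time set R_+ is encoded by all of R with guards 0 <= t; the values
   Phi t x for t < 0 are unconstrained and never used. *)
Record svds (R : realType) (M : metricType R) := Svds {
  svds_map :> R -> M -> set M ;
  svds_nonempty : forall t x, 0 <= t -> svds_map t x !=set0 ;
  svds_closed : forall t x, 0 <= t -> closed (svds_map t x) ;
  svds0 : forall x, svds_map 0 x = [set x] ;
  svdsD : forall s t x, 0 <= s -> 0 <= t ->
    \bigcup_(y in svds_map s x) svds_map t y = svds_map (t + s) x ;
  svds_continuous_time : forall x t, 0 <= t -> forall eps : R, 0 < eps ->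
    exists2 delta : R, 0 < delta & forall s, 0 <= s -> `|s - t| < delta ->
      (hausdorff_dist (svds_map s x) (svds_map t x) < eps%:E)%E ;
  svds_usc : forall t, 0 <= t -> forall (x0 : M) (eps : R), 0 < eps ->
    exists2 delta : R, 0 < delta & forall x, ball x0 delta x ->
      (semi_hausdorff (svds_map t x) (svds_map t x0) < eps%:E)%E }.

(* [{family compact, _ -> _}] is the topology of uniform convergence on compact
   sets. *)
Definition path_space (R : realType) (M : metricType R) : Type :=
  continuousType R M.

HB.instance Definition _ (R : realType) (M : metricType R) :=
  Topological.copy (path_space M)
    (initial_topology
      ((fun y => y : R -> M) : continuousType R M -> {family compact, R -> M})).
HB.instance Definition _ (R : realType) (M : pmetricType R) :=
  isPointed.Build (path_space M) (cst (point : M) : continuousType R M).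

Definition orbit_space (T : Type) : Type := {ptws int -> T}.

HB.instance Definition _ (T : topologicalType) :=
  Topological.copy (orbit_space T) {ptws int -> T}.
HB.instance Definition _ (T : ptopologicalType) :=
  isPointed.Build (orbit_space T) (fun=> point).

Notation borel T := (g_sigma_algebraType (@open T)).

Notation borel_probability T R := (probability (borel T) R).

Section dynamics.
Context {R : realType} {M : metricType R}.

Definition entire_solution (Phi : svds M) (z : R -> M) : Prop :=
  forall s t, s <= t -> Phi (t - s) (z s) (z t).

(* Restricting to continuous paths loses nothing: for compact M, entire
   solutions are automatically continuous. *)
Definition solutions (Phi : svds M) : set (path_space M) :=
  [set y | entire_solution Phi (y : continuousType R M)].

Lemma translate_continuous (t : R) (y : continuousType R M) :
  continuous (fun s => y (t + s)).
Proof.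
move=> s; apply: (@continuous_comp _ _ _ (fun s : R => t + s) y).
  by apply: cvgD; [exact: cvg_cst | exact: cvg_id].
exact: cts_fun.
Qed.

Definition translate (t : R) (y : path_space M) : path_space M :=
  (mkcts (@translate_continuous t y) : continuousType R M).

Definition path_eval0 (y : path_space M) : M := (y : continuousType R M) 0.

Definition discrete_orbits (Phi : svds M) (t : R) : set (orbit_space M) :=
  [set x | forall i : int, Phi t (x i) (x (i + 1))].

Definition orbit_shift (x : orbit_space M) : orbit_space M := fun i => x (i + 1).

Definition orbit_eval0 (x : orbit_space M) : M := x 0.

End dynamics.

(* Elements of [probability T R] are functions on all subsets of T, only
   meaningful on measurable ones; equalities of measures are therefore always
   required on measurable sets only. *)
Section invariant_measures.
Context {R : realType} {M : pmetricType R}.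
Implicit Types (Phi : svds M) (mu : borel_probability M R).

(* A measure on a closed subset is a measure on the ambient space for which the
   complement of that subset is negligible. *)
Definition discrete_invariant Phi mu : Prop :=
  forall t : R, 0 <= t ->
  exists nu : borel_probability (orbit_space M) R,
    [/\ nu.-negligible (~` discrete_orbits Phi t),
        forall A : set (borel M), measurable A ->
          pushforward nu (orbit_eval0 : _ -> borel M) A = mu A
      & forall A : set (borel (orbit_space M)), measurable A ->
          nu (orbit_shift @^-1` A) = nu A].

Definition flow_invariant Phi mu : Prop :=
  exists nu : borel_probability (path_space M) R,
    [/\ nu.-negligible (~` solutions Phi),
        forall A : set (borel M), measurable A ->
          pushforward nu (path_eval0 : _ -> borel M) A = mu A
      & forall (t : R) (A : set (borel (path_space M))), measurable A ->
          nu (translate t @^-1` A) = nu A].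

(* Either of the two equivalent conditions may be taken as the definition. *)
Definition invariant_measures Phi : set (borel_probability M R) :=
  [set mu | flow_invariant Phi mu].

End invariant_measures.

Section probability_space.
Context {R : realType} {T : ptopologicalType}.

(* The weak* topology: the coarsest one making mu |-> \int f dmu continuous for
   every f in C(T), for compact T *)
Definition weak_star : Type := borel_probability T R.

HB.instance Definition _ := Topological.copy weak_star
  (initial_topology ((fun mu f => Rintegral mu setT f) :
    borel_probability T R -> {ptws continuousType T R -> R})).

End probability_space.
Arguments weak_star R T : clear implicits.

Section mixture.
Context d (T : measurableType d) {R : realType}.
Variables (p : {i01 R}) (mu1 mu2 : probability T R).

Definition mixture (A : set T) : \bar R :=
  (p%:num%:E * mu1 A + (1 - p%:num)%:E * mu2 A)%E.

Let mixtureE : mixture = measure_add (mscale (p%:num)%:nng mu1)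
  (mscale (1 - p%:num)%:nng mu2).
Proof. by apply/funext => A; rewrite measure_addE. Qed.

Let mixture0 : mixture set0 = 0%E.
Proof. by rewrite /mixture !measure0 !mule0 adde0. Qed.

Let mixture_ge0 A : (0 <= mixture A)%E.
Proof. by rewrite /mixture adde_ge0// mule_ge0. Qed.

Let mixture_sigma_additive : semi_sigma_additive mixture.
Proof.
by rewrite mixtureE /measure_add; exact: measure_semi_sigma_additive.
Qed.

HB.instance Definition _ := isMeasure.Build _ _ _ mixture
  mixture0 mixture_ge0 mixture_sigma_additive.

Let mixture_setT : mixture setT = 1%E.
Proof. by rewrite /mixture !probability_setT !mule1 -EFinD subrKC. Qed.

HB.instance Definition _ :=
  Measure_isProbability.Build _ _ _ mixture mixture_setT.

End mixture.

Definition convex_probabilities d (T : measurableType d) (R : realType)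
    (P : set (probability T R)) : Prop :=
  forall (p : {i01 R}) (mu1 mu2 : probability T R),
    P mu1 -> P mu2 -> P (mixture p mu1 mu2).

(* Main.v *)
Require Import Defs.
From HB Require Import structures.
From mathcomp Require Import all_boot all_order all_algebra.
From mathcomp Require Import interval_inference lra zify.
From mathcomp Require Import all_classical all_reals all_analysis.
Set Implicit Arguments.
Unset Strict Implicit.
Unset Printing Implicit Defensive.
Import Order.TTheory GRing.Theory Num.Theory.
Import numFieldNormedType.Exports.
Local Open Scope classical_set_scope.
Local Open Scope ring_scope.

(** The proof rests on two facts.

    The first concerns the system alone: [Phi s x] is close to [x] for small
    [s], uniformly in [x] ([svds_uniform0]). Continuity in time and upper
    semicontinuity in space are only assumed separately; Baire's theorem, applied
    to the small times at which images of a convergent sequence stay near its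
    limit, makes them joint. Solutions are therefore equicontinuous. A function
    on the rationals that respects the transitions of [Phi] extends to an entire
    solution ([rational_extension]), and the extension depends continuously on
    the function when these functions carry the product topology, which is
    compact ([extension_borel]).

    The second replaces weak compactness of the set of probabilities. On a
    compact Hausdorff space a finitely additive probability [m] on the Borel
    sets has a regular part: a countably additive one whose value on an open
    set [V] is the supremum of [m F] over the closed subsets [F] of [V]
    ([regular_part]). It is at most [m] on open sets, so it keeps the closed
    sets of full mass, and it inherits the invariance of [m] under
    homeomorphisms. Finitely additive probabilities are plentiful: the pointwise
    limit of probabilities along an ultrafilter is one ([fa_ulim]).

    Combining them ([invariant_lift]): a finitely additive probability on
    functions over the rationals that gives mass one to each transition
    constraint and is invariant under rational translations has a regular part
    which lives on rational solutions. Its image on continuous paths lives on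
    entire solutions and is invariant under all translations, because translates
    of a solution depend continuously on the time. The marginal at time [0] is
    dominated on open sets by that of [m].

    Each claim is then a choice of [m]. For the implication from (i) to (ii),
    [m] is an ultralimit of the discrete measures with step [1/n!] seen as laws
    of step functions; their marginal is constantly [mu], and probabilities on a
    metric space ordered on open sets are equal ([open_dominated_eq]). For
    existence, [m] is an ultralimit of empirical averages along discrete forward
    orbits, as in the Krylov-Bogoliubov theorem. For compactness, [m] is the
    limit, along an ultrafilter of invariant measures, of associated laws of
    paths; domination on open sets upgrades to convergence of integrals of
    continuous functions ([portmanteau_Rintegral]). The implication from (ii) to
    (i) samples paths at the multiples of [t], and convexity mixes laws of
    paths. *)

(** * Borel measures *)

Lemma open_borel (T : ptopologicalType) (A : set T) :
  open A -> measurable (A : set (borel T)).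
Proof. by move=> oA; exact: sub_sigma_algebra. Qed.

Lemma closed_borel (T : ptopologicalType) (A : set T) :
  closed A -> measurable (A : set (borel T)).
Proof.
move=> cA; rewrite -(setCK A); apply: (@measurableC _ (borel T)).
by apply: open_borel; exact: closed_openC.
Qed.

Lemma continuous_borel (S T : ptopologicalType) (f : S -> T) :
  continuous f -> measurable_fun [set: borel S] (f : borel S -> borel T).
Proof.
move=> cf; apply: (@measurability _ _ (borel S) (borel T) _ _ (@open T)) => //.
move=> _ [A oA <-]; rewrite setTI; apply: open_borel.
by move/continuousP : cf; exact.
Qed.

Lemma preimage_borel (S T : ptopologicalType) (f : S -> T) (A : set T) :
  continuous f -> measurable (A : set (borel T)) ->
  measurable (f @^-1` A : set (borel S)).
Proof.
by move=> cf mA; have := continuous_borel cf measurableT mA; rewrite setTI.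
Qed.

Lemma eq_borel_measure (R : realType) (T : ptopologicalType)
    (mu nu : borel_probability T R) :
  (forall A : set T, open A -> mu A = nu A) ->
  forall A, measurable A -> mu A = nu A.
Proof.
move=> mn A mA.
apply: (@measure_unique _ R (borel T) (@open T) (fun=> setT)) => //.
- by move=> B C oB oC; exact: openI.
- by move=> _; exact: openT.
- by rewrite bigcup_const//; exists O.
- by move=> _; apply: le_lt_trans (probability_le1 mu _) (ltry _); exact: measurableT.
Qed.

Lemma image_probability (R : realType) (S T : ptopologicalType)
    (mu : borel_probability S R) (f : S -> T) :
  measurable_fun [set: borel S] (f : borel S -> borel T) ->
  exists nu : borel_probability T R, forall A, nu A = mu (f @^-1` A).
Proof.
move=> mf.
pose X : {mfun (borel S) >-> (borel T)} :=
  HB.pack (f : borel S -> borel T) (isMeasurableFun.Build _ _ _ _ _ mf).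
by exists (distribution mu X).
Qed.

Lemma le_measure_null d (T : measurableType d) (R : realType)
    (mu : {measure set T -> \bar R}) (A B N : set T) :
  measurable A -> measurable B -> measurable N -> mu N = 0%E ->
  A `<=` B `|` N -> (mu A <= mu B)%E.
Proof.
move=> mA mB mN N0 ABN; rewrite -(measureU0 mB mN N0).
by apply: le_measure; rewrite ?inE//; exact: measurableU.
Qed.

(** * Finitely additive probabilities *)

Definition finitely_additive (R : realType) (T : ptopologicalType)
    (m : set T -> R) : Prop :=
  [/\ m setT = 1, forall A : set (borel T), measurable A -> 0 <= m A
    & forall A B : set (borel T), measurable A -> measurable B ->
        A `&` B = set0 -> m (A `|` B) = m A + m B].

Section finitely_additive_theory.
Context (R : realType) (T : ptopologicalType) (m : set T -> R).
Hypothesis mP : finitely_additive m.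
Implicit Types A B : set (borel T).

Lemma fa_setT : m setT = 1. Proof. by case: mP. Qed.

Lemma fa_ge0 A : measurable A -> 0 <= m A.
Proof. by case: mP => _ + _; exact. Qed.

Lemma fa_setU A B : measurable A -> measurable B -> A `&` B = set0 ->
  m (A `|` B) = m A + m B.
Proof. by case: mP => _ _; exact. Qed.

Lemma fa_set0 : m set0 = 0.
Proof.
have := @fa_setU set0 set0 measurable0 measurable0 (setI0 _).
by rewrite setU0; lra.
Qed.

Lemma fa_setD A B : measurable A -> measurable B -> A `<=` B ->
  m B = m A + m (B `\` A).
Proof.
move=> mA mB AB; rewrite -fa_setU ?setDIK ?setDUK//.
exact: measurableD.
Qed.

Lemma fa_le A B : measurable A -> measurable B -> A `<=` B -> m A <= m B.
Proof.
move=> mA mB AB; rewrite (fa_setD mA mB AB) lerDl fa_ge0//.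
exact: measurableD.
Qed.

Lemma fa_setC A : measurable A -> m (~` A) = 1 - m A.
Proof.
move=> mA; have := fa_setD mA measurableT (@subsetT _ A).
by rewrite fa_setT setTD; lra.
Qed.

Lemma fa_le1 A : measurable A -> m A <= 1.
Proof. by move=> mA; rewrite -fa_setT fa_le. Qed.

Lemma fa_setU_le A B : measurable A -> measurable B ->
  m (A `|` B) <= m A + m B.
Proof.
move=> mA mB; have mBA : measurable (B `\` A) by exact: measurableD.
have -> : A `|` B = A `|` (B `\` A).
  by rewrite setUDr setDv setD0.
by rewrite fa_setU ?setDIK// lerD2l fa_le.
Qed.

End finitely_additive_theory.

(** * The regular part of a finitely additive probability *)

(** Separating [F] minus [V] from [F] minus [W] by disjoint open sets, and
    removing one or the other from [F], yields the two pieces. *)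
Lemma closed_split (R : realType) (T : topologicalType) (F V W : set T) :
  normal_space T -> closed F -> open V -> open W -> F `<=` V `|` W ->
  exists F1 F2, [/\ closed F1, closed F2, F1 `<=` V, F2 `<=` W
    & F = F1 `|` F2].
Proof.
move=> nT cF oV oW FVW.
have [|||U1 [U2 [oU1 oU2 FU1 FU2 U12]]] :=
    (@normal_openP R T).1 nT (F `&` ~` V) (F `&` ~` W).
- by apply: closedI => //; exact: open_closedC.
- by apply: closedI => //; exact: open_closedC.
- rewrite -subset0 => x [[Fx nVx] [_ nWx]].
  by case: (FVW _ Fx).
exists (F `&` ~` U1), (F `&` ~` U2); split.
- by apply: closedI => //; exact: open_closedC.
- by apply: closedI => //; exact: open_closedC.
- by move=> x [Fx nU1]; apply: contrapT => nVx; apply: nU1; exact: FU1.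
- by move=> x [Fx nU2]; apply: contrapT => nWx; apply: nU2; exact: FU2.
- rewrite -setIUr -setCI U12 setC0 setIT//.
Qed.


Definition inner_mass (R : realType) (T : topologicalType) (m : set T -> R)
    (V : set T) : \bar R :=
  ereal_sup [set (m F)%:E | F in [set F | closed F /\ F `<=` V]].

(** The outer measure whose restriction to Borel sets is the regular part. *)
Definition regular_outer (R : realType) (T : topologicalType) (m : set T -> R)
    (A : set T) : \bar R :=
  ereal_inf [set inner_mass m V | V in [set V | open V /\ A `<=` V]].

Section regular_part.
Context (R : realType) (T : ptopologicalType) (m : set T -> R).
Hypotheses (mP : finitely_additive m) (hT : hausdorff_space T)
  (cT : compact [set: T]).
Local Open Scope ereal_scope.
Implicit Types V W F : set T.

Let normalT : normal_space T. Proof. exact: compact_normal. Qed.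

Local Notation outer := (regular_outer m).

Lemma inner_mass_ge V F : closed F -> F `<=` V -> (m F)%:E <= inner_mass m V.
Proof. by move=> cF FV; apply: ereal_sup_ubound; exists F. Qed.

Lemma inner_mass_le V : open V -> inner_mass m V <= (m V)%:E.
Proof.
move=> oV; apply: ge_ereal_sup => _ [F [cF FV] <-]; rewrite lee_fin.
by apply: fa_le => //; [exact: closed_borel|exact: open_borel].
Qed.

Lemma inner_mass_ge0 V : 0 <= inner_mass m V.
Proof.
by rewrite -[0]/(0%:E) -(fa_set0 mP) inner_mass_ge//; exact: closed0.
Qed.

Lemma inner_mass_homo V W : V `<=` W -> inner_mass m V <= inner_mass m W.
Proof.
move=> VW; apply: ge_ereal_sup => _ [F [cF FV] <-].
by apply: inner_mass_ge => //; exact: subset_trans VW.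
Qed.

Lemma inner_mass_fin V : inner_mass m V \is a fin_num.
Proof.
rewrite ge0_fin_numE ?inner_mass_ge0//.
apply: (@le_lt_trans _ _ 1); last exact: ltry.
by apply: ge_ereal_sup => _ [F [cF FV] <-]; rewrite lee_fin fa_le1//;
  exact: closed_borel.
Qed.

Lemma inner_mass0 : inner_mass m set0 = 0.
Proof.
by apply/eqP; rewrite eq_le inner_mass_ge0 andbT -[0]/(0%:E)
  -(fa_set0 mP) inner_mass_le//; exact: open0.
Qed.

Lemma inner_massT : inner_mass m setT = 1.
Proof.
apply/eqP; rewrite eq_le -[1]/(1%:E) -(fa_setT mP) inner_mass_le//=; last exact: openT.
by apply: inner_mass_ge => //; exact: closedT.
Qed.

Lemma inner_mass_adherent V (e : R) : (0 < e)%R ->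
  exists F, [/\ closed F, F `<=` V & inner_mass m V <= (m F)%:E + e%:E].
Proof.
move=> e0; have [_ [F [cF FV] <-] VF] :=
  ub_ereal_sup_adherent e0 (inner_mass_fin V).
by exists F; split=> //; rewrite -leeBlDr// ltW.
Qed.

Lemma finite_inner_mass F (V : (set T)^nat) n : closed F ->
  (forall i, open (V i)) -> F `<=` \big[setU/set0]_(i < n) V i ->
  (m F)%:E <= \sum_(i < n) inner_mass m (V i).
Proof.
move=> + oV; elim: n F => [|n IH] F cF.
  by rewrite !big_ord0 subset0 => ->; rewrite (fa_set0 mP).
rewrite !big_ord_recr/= => FV.
have [|F1 [F2 [cF1 cF2 F1V F2V ->]]] := closed_split R normalT cF _ (oV n) FV.
  by rewrite -bigcup_mkord; exact: bigcup_open.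
apply: (@le_trans _ _ ((m F1)%:E + (m F2)%:E)).
  by rewrite -EFinD lee_fin fa_setU_le//; exact: closed_borel.
by apply: leeD; [exact: IH|exact: inner_mass_ge].
Qed.

(** By compactness a closed subset of the union lies in a finite subunion; this
    is where countable additivity comes from. *)
Lemma inner_mass_bigcup (V : (set T)^nat) : (forall i, open (V i)) ->
  inner_mass m (\bigcup_i V i) <= \sum_(i <oo) inner_mass m (V i).
Proof.
move=> oV; apply: ge_ereal_sup => _ [F [cF FV] <-].
have cptF : compact F by apply: (subclosed_compact cF cT).
move: cptF; rewrite compact_cover => /(_ _ setT V) [//|//|D _ FD].
pose n := (\max_(i <- finmap.enum_fset D) i).+1.
have Fn : F `<=` \big[setU/set0]_(i < n) V i.
  move=> x /FD [i /= iD Vix]; rewrite -bigcup_mkord; exists i => //=.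
  rewrite ltnS.
  exact: (@leq_bigmax_seq _ _ xpredT id).
apply: le_trans (finite_inner_mass cF oV Fn) _.
rewrite -(big_mkord xpredT (fun i => inner_mass m (V i))).
by apply: nneseries_lim_ge => k _ _; exact: inner_mass_ge0.
Qed.

Lemma regular_outer_le A V : open V -> A `<=` V -> outer A <= inner_mass m V.
Proof. by move=> oV AV; apply: ereal_inf_lbound; exists V. Qed.

Lemma le_regular_outer A x :
  (forall V, open V -> A `<=` V -> x <= inner_mass m V) -> x <= outer A.
Proof. by move=> xV; apply/ereal_infP => _ [V [oV AV] <-]; exact: xV. Qed.

Lemma regular_outer_open V : open V -> outer V = inner_mass m V.
Proof.
move=> oV; apply/eqP; rewrite eq_le regular_outer_le//=.
by apply: le_regular_outer => W oW VW; exact: inner_mass_homo.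
Qed.

Lemma regular_outer_ge0 A : 0 <= outer A.
Proof. by apply: le_regular_outer => V _ _; exact: inner_mass_ge0. Qed.

Lemma regular_outer_fin A : outer A \is a fin_num.
Proof.
rewrite ge0_fin_numE ?regular_outer_ge0//.
apply: (@le_lt_trans _ _ 1); last exact: ltry.
by rewrite -inner_massT regular_outer_le//; exact: openT.
Qed.

Lemma regular_outer_adherent A (e : R) : (0 < e)%R ->
  exists V, [/\ open V, A `<=` V & inner_mass m V <= outer A + e%:E].
Proof.
move=> e0; have [_ [V [oV AV] <-] VA] :=
  lb_ereal_inf_adherent e0 (regular_outer_fin A).
by exists V; split=> //; exact: ltW.
Qed.

Let outer0 : outer set0 = 0.
Proof. by rewrite regular_outer_open ?inner_mass0//; exact: open0. Qed.

Let outer_homo : {homo outer : A B / A `<=` B >-> A <= B}.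
Proof.
move=> A B AB; apply: le_regular_outer => V oV BV.
by apply: regular_outer_le => //; exact: subset_trans BV.
Qed.

Let outer_subadditive : sigma_subadditive outer.
Proof.
move=> A; apply/lee_addgt0Pr => e e0.
have e_gt0 n : (0 < e / (2 ^ n.+1)%:R)%R.
  by rewrite divr_gt0// ltr0n expn_gt0.
have /choice[V VP] n := regular_outer_adherent (A n) (e_gt0 n).
apply: (@le_trans _ _ (inner_mass m (\bigcup_n V n))).
  apply: regular_outer_le.
    by apply: bigcup_open => n _; case: (VP n).
  by apply: subset_bigcup => n _; case: (VP n).
apply: le_trans (inner_mass_bigcup _) _; first by move=> n; case: (VP n).
apply: le_trans (epsilon_trick xpredT _ (ltW e0)) => //.
  apply: lee_nneseries => n _ /=; last by case: (VP n).
  by move=> _; exact: inner_mass_ge0.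
by move=> n; exact: regular_outer_ge0.
Qed.

HB.instance Definition _ := isOuterMeasure.Build R T outer
  outer0 regular_outer_ge0 outer_homo outer_subadditive.

(** Open supersets [W] split almost exactly: exhaust the intersection of [W] and
    [V] from inside by a closed [F], then [W] minus [F] from inside by a closed
    [F']; the disjoint union of [F] and [F'] lies in [W]. *)
Let caratheodory_open V : open V -> caratheodory_measurable outer V.
Proof.
move=> oV; apply: le_caratheodory_measurable => A.
apply/lee_addgt0Pr => e e0.
have e3 : (0 < e / 3)%R by rewrite divr_gt0.
have [W [oW AW WA]] := regular_outer_adherent A e3.
have [F [cF FWV WVF]] := inner_mass_adherent (W `&` V) e3.
have oWF : open (W `&` ~` F) by apply: openI => //; exact: closed_openC.
have [F' [cF' F'W WF']] := inner_mass_adherent (W `&` ~` F) e3.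
have AV : outer (A `&` V) <= inner_mass m (W `&` V).
  by apply: regular_outer_le; [exact: openI|exact: setSI].
have ACV : outer (A `&` ~` V) <= inner_mass m (W `&` ~` F).
  apply: regular_outer_le => //.
  by move=> x [Ax nVx]; split; [exact: AW|move=> /FWV[]].
have mFF' : (m F)%:E + (m F')%:E <= inner_mass m W.
  have FF'0 : F `&` F' = set0 by rewrite -subset0 => x [Fx /F'W[]].
  rewrite -EFinD -(fa_setU mP (closed_borel cF) (closed_borel cF') FF'0).
  apply: inner_mass_ge; first exact: closedU.
  by rewrite subUset; split => x; [move/FWV => []|move/F'W => []].
apply: (@le_trans _ _ ((m F)%:E + (e / 3)%:E + ((m F')%:E + (e / 3)%:E))).
  by apply: leeD; [exact: le_trans AV WVF|exact: le_trans ACV WF'].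
have -> : e%:E = (e / 3)%:E + ((e / 3)%:E + (e / 3)%:E).
  by rewrite -!EFinD; congr EFin; lra.
rewrite addeACA [leRHS]addeA; apply: leeD => //.
exact: le_trans mFF' WA.
Qed.

Let lambda : set (borel T) -> \bar R := outer.

Let borel_caratheodory (A : set (borel T)) : measurable A ->
  caratheodory_measurable outer A.
Proof.
apply: smallest_sub; last by move=> V; exact: caratheodory_open.
split=> [|B|B].
- exact: caratheodory_measurable_set0.
- by rewrite setTD; exact: caratheodory_measurable_setC.
- exact: caratheodory_measurable_bigcup.
Qed.

Let lambda0 : lambda set0 = 0. Proof. exact: outer0. Qed.

Let lambda_ge0 A : 0 <= lambda A. Proof. exact: regular_outer_ge0. Qed.

Let lambda_sigma_additive : semi_sigma_additive lambda.
Proof.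
move=> A mA tA mUA.
apply: (@caratheodory_measure_sigma_additive R T outer A) => //.
  by move=> i; exact: borel_caratheodory.
exact: borel_caratheodory.
Qed.

HB.instance Definition _ := isMeasure.Build _ (borel T) R lambda
  lambda0 lambda_ge0 lambda_sigma_additive.

Let lambdaT : lambda setT = 1.
Proof. by rewrite /lambda regular_outer_open ?inner_massT//; exact: openT. Qed.

HB.instance Definition _ :=
  Measure_isProbability.Build _ (borel T) R lambda lambdaT.

Theorem regular_part : exists nu : borel_probability T R,
  forall V, open V -> nu V = inner_mass m V.
Proof.
exists (lambda : probability _ _) => V oV; exact: regular_outer_open.
Qed.

End regular_part.

(** * Uniform continuity of set-valued dynamical systems at time zero *)

Lemma semi_hausdorff_lt (R : realType) (M : metricType R) (A B : set M) (e : R) :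
  (semi_hausdorff A B < e%:E)%E ->
  forall a, A a -> exists2 b, B b & mdist a b < e.
Proof.
move=> AB a Aa.
have : (point_set_dist a B < e%:E)%E.
  by apply: le_lt_trans AB; apply: ereal_sup_ubound; exists a.
by move=> /ereal_inf_lt[_ [b Bb <-]]; rewrite lte_fin; exists b.
Qed.

(** Otherwise the complements of the [G n] would be dense open in the interval,
    and Baire's theorem would contradict the cover. *)
Lemma baire_interval (R : realType) (G : (set R)^nat) (a b : R) : a < b ->
  (forall n, closed (G n)) -> `]a, b[ `<=` \bigcup_n G n ->
  exists n c d, [/\ a <= c, c < d, d <= b & `]c, d[ `<=` G n].
Proof.
move=> ab cG abG; apply: contrapT => nG.
(* Adding the complement of the closed interval makes these sets dense in the
   whole line, as required to apply Baire's theorem there. *)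
pose O n := ~` (G n) `|` ~` `[a, b].
have oO n : open (O n).
  by apply: openU; apply: closed_openC => //; exact: interval_closed.
have dO n : dense (O n).
  move=> D [x Dx] oD; apply: contrapT => nDO.
  have DG : D `<=` G n `&` `[a, b].
    move=> y Dy; split; apply: contrapT => nGy; apply: nDO; exists y; split=> //.
      by left.
    by right.
  have [/= xG xab] := DG _ Dx.
  have := oD; rewrite openE => /(_ _ Dx); rewrite /interior /=.
  move=> /(@nbhs_ballP _ R^o) [e /= e0 De].
  have xe : `]x - e, x + e[ `<=` D.
    move=> y /=; rewrite in_itv/= => /andP[yx xy]; apply: De.
    by rewrite /ball/= ltr_norml; lra.
  have mid y : `]x - e, x + e[%classic y -> a <= y <= b.
    by move=> /xe/DG[_]/=; rewrite in_itv.
  apply: nG; exists n, (x - e / 2), (x + e / 2).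
  have := mid (x - e/2); have := mid (x + e/2); rewrite /= !in_itv/=.
  move=> /(_ _)/andP[|_ ->]; first by lra.
  move=> /(_ _)/andP[|-> _]; first by lra.
  split=> //; first by lra.
  move=> y /=; rewrite in_itv/= => yxe.
  by have /DG[] : D y by apply: xe; rewrite /= in_itv/=; lra.
have := @Baire R R^o O (fun n => conj (oO n) (dO n)).
move=> /(_ `]a, b[%classic)[||x [xab xO]].
- by exists ((a + b) / 2); rewrite /= in_itv/=; lra.
- exact: interval_open.
- have [n _ Gx] := abG _ xab; have [//|] := xO n I.
  by apply; apply: subset_itv_oo_cc.
Qed.

Section svds_theory.
Context (R : realType) (M : metricType R) (Phi : svds M).
Hypothesis compactM : compact [set: M].
Local Notation d := (@mdist R M).
Implicit Types (x y : M) (s t e : R).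

Lemma svds_near_time x t e : 0 <= t -> 0 < e ->
  exists2 delta, 0 < delta & forall s, 0 <= s -> `|s - t| < delta ->
    (forall a, Phi s x a -> exists2 b, Phi t x b & d a b < e) /\
    (forall a, Phi t x a -> exists2 b, Phi s x b & d a b < e).
Proof.
move=> t0 e0; have [delta d0 H] := svds_continuous_time Phi x t0 e0.
exists delta => // s s0 st; have := H s s0 st.
by rewrite gt_max => /andP[st1 st2]; split; exact: semi_hausdorff_lt.
Qed.

Lemma svds_near0 x e : 0 < e ->
  exists2 delta, 0 < delta & forall s, 0 <= s < delta ->
    forall a, Phi s x a -> d x a < e.
Proof.
move=> e0; have [delta d0 H] := svds_near_time x (lexx 0) e0.
exists delta => // s /andP[s0 sd] a xa.
have [|/(_ _ xa)[b + ab] _] := H s s0; first by rewrite subr0 ger0_norm.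
by rewrite svds0 => <-; rewrite metric_sym.
Qed.

Lemma svds_near_space x t e : 0 <= t -> 0 < e ->
  exists2 delta, 0 < delta & forall y, d x y < delta ->
    forall a, Phi t y a -> exists2 b, Phi t x b & d a b < e.
Proof.
move=> t0 e0; have [delta d0 H] := svds_usc Phi t0 x e0.
exists delta => // y xy; apply: semi_hausdorff_lt; apply: H.
by rewrite ballEmdist.
Qed.

Lemma svds_comp s t x y z : 0 <= s -> 0 <= t -> Phi s x y -> Phi t y z ->
  Phi (t + s) x z.
Proof. by move=> s0 t0 xy yz; rewrite -svdsD//; exists y. Qed.

Lemma svds_decomp s t x z : 0 <= s -> 0 <= t -> Phi (t + s) x z ->
  exists2 y, Phi s x y & Phi t y z.
Proof. by move=> s0 t0; rewrite -svdsD//. Qed.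

(** Closedness of these sets of times, to which Baire's theorem will be applied,
    is the one use of Hausdorff continuity in time away from time zero. *)
Lemma closed_near_times (y_ : nat -> M) y e n :
  closed [set h : R | 0 <= h /\ forall m, (n <= m)%N ->
    forall a, Phi h (y_ m) a -> d y a <= e].
Proof.
move=> h clh; have h0 : 0 <= h.
  rewrite leNgt; apply/negP => h0.
  have nh : 0 < - h by lra.
  have [k [[k0 _]]] := clh _ (@nbhsx_ballx _ R^o h _ nh).
  by rewrite /ball/= ltr_norml; lra.
split=> // m nm a ha; apply/ler_addgt0Pr => r r0.
have [delta delta0 H] := svds_near_time (y_ m) h0 r0.
have [k [[k0 Hk]]] := clh _ (@nbhsx_ballx _ R^o h _ delta0).
rewrite /ball/= distrC => kh.
have [_ /(_ _ ha)[b yb ab]] := H _ k0 kh.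
apply: le_trans (metric_triangle _ b _) _.
by apply: lerD; [exact: Hk yb|rewrite metric_sym ltW].
Qed.

(** For a sequence converging to [y], at each fixed small time the images are
    eventually close to [y] by upper semicontinuity; by Baire this happens
    uniformly over some interval of times. *)
Lemma uniform_interval (y_ : nat -> M) y e a b : 0 < e -> 0 <= a < b ->
  (forall h, h < b -> 0 <= h -> forall z, Phi h y z -> d y z < e) ->
  (forall r, 0 < r -> exists n, forall m, (n <= m)%N -> d y (y_ m) < r) ->
  exists n a' b', [/\ a <= a', a' < b', b' <= b &
    forall h, a' < h < b' -> forall m, (n <= m)%N ->
      forall z, Phi h (y_ m) z -> d y z <= e + e].
Proof.
move=> e0 /andP[a0 ab] yb ycvg.
pose G n := [set h : R | 0 <= h /\ forall m, (n <= m)%N ->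
  forall z, Phi h (y_ m) z -> d y z <= e + e].
have [n|h /= hab|n [a' [b' [aa' ab' bb' GG]]]] := @baire_interval R G a b ab.
- exact: closed_near_times.
- move: hab; rewrite in_itv/= => /andP[ah hb].
  have h0 : 0 <= h by lra.
  have [delta delta0 H] := svds_near_space y h0 e0.
  have [n Hn] := ycvg _ delta0.
  exists n => //; split=> // m nm z yz.
  have [w yw zw] := H _ (Hn m nm) _ yz.
  apply: le_trans (metric_triangle _ w _) _.
  by rewrite [d w z]metric_sym lerD// ltW//; exact: yb h hb h0 w yw.
- exists n, a', b'; split=> // h hab m nm z yz.
  have hG : `]a', b'[%classic h by rewrite /= in_itv/=.
  by have [_ H] := GG h hG; exact: H yz.
Qed.

(** A cluster point of the filter generated by the [B r], for sets of pairs that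
    shrink with [r]. *)
Lemma compact_cluster_pair (B : R -> set (M * M)) :
  (forall r, 0 < r -> B r !=set0) ->
  (forall r r', 0 < r -> r <= r' -> B r `<=` B r') ->
  exists x y, forall r, 0 < r ->
    exists p, [/\ B r p, d x p.1 < r & d y p.2 < r].
Proof.
move=> B0 Bmono.
pose F := filter_from [set r : R | 0 < r] B.
have FF : ProperFilter F.
  apply: filter_from_proper; last by move=> r r0; exact: B0.
  apply: filter_from_filter; first by exists 1; exact: ltr01.
  move=> r r' /= r0 r0'; exists (Num.min r r') => /=; first by rewrite lt_min r0.
  have rr : 0 < Num.min r r' by rewrite lt_min r0.
  by move=> p Bp; split; apply: Bmono Bp => //; rewrite ge_min lexx ?orbT.
have [[x y] [_ clxy]] : [set: M] `*` [set: M] `&` cluster F !=set0.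
  by apply: (compact_setX compactM compactM); apply: filterS filterT => -[].
exists x, y => r r0.
have [||[a b] [Bab [/= xa yb]]] := clxy (B r) (ball x r `*` ball y r).
- by exists r.
- by exists (ball x r, ball y r) => //; split; exact: nbhsx_ballx.
- by exists (a, b); move: xa yb; rewrite !ballEmdist.
Qed.

Lemma seq_near (x_ : nat -> M) x :
  (forall n, d x (x_ n) < n.+1%:R^-1) ->
  forall r, 0 < r -> exists n, forall m, (n <= m)%N -> d x (x_ m) < r.
Proof.
move=> xn r r0; have [n _ nr] := near_infty_natSinv_lt (PosNum r0).
exists n => m nm; apply: lt_trans (xn m) _; exact: nr.
Qed.

(** A failure produces, by compactness, [x_ n] tending to [x], [s_ n] to zero and
    [y_ n] in [Phi (s_ n) (x_ n)] tending to some [y] other than [x]. On a common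
    interval of small times [h], [Phi h (x_ n)] stays near [x], while its subset
    [Phi (h - s_ n) (y_ n)] stays near [y]: hence [x] is near [y]. *)
Theorem svds_uniform0 e : 0 < e -> exists2 delta, 0 < delta &
  forall x s a, 0 <= s < delta -> Phi s x a -> d x a < e.
Proof.
move=> e0; apply: contrapT => nH.
pose B r := [set p | exists s, [/\ 0 <= s < r, Phi s p.1 p.2 & e <= d p.1 p.2]].
have [r r0|r r' _ rr p [s [/andP[s0 sr] ? ?]]|x [y xy]] := @compact_cluster_pair B.
- apply: contrapT => nB; apply: nH; exists r => // x s a sr xa.
  by rewrite ltNge; apply/negP => ea; apply: nB; exists (x, a), s.
- by exists s; split => //; rewrite s0 (lt_le_trans sr).
have /choice[p_ Pp] (n : nat) : exists p : M * M, [/\ B n.+1%:R^-1 p,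
    d x p.1 < n.+1%:R^-1 & d y p.2 < n.+1%:R^-1].
  by apply: xy; rewrite invr_gt0.
have /choice[s_ Ps] (n : nat) : exists s, [/\ 0 <= s < n.+1%:R^-1,
   Phi s (p_ n).1 (p_ n).2 & e <= d (p_ n).1 (p_ n).2] by case: (Pp n).
have xcvg : forall r, 0 < r -> exists n, forall m, (n <= m)%N -> d x (p_ m).1 < r.
  by apply: (@seq_near (fst \o p_)) => n; case: (Pp n).
have ycvg : forall r, 0 < r -> exists n, forall m, (n <= m)%N -> d y (p_ m).2 < r.
  by apply: (@seq_near (snd \o p_)) => n; case: (Pp n).
(* Six errors of size e / 7 add up below: two from each use of
   uniform_interval, and one from each of the convergent sequences. *)
have e7 : 0 < e / 7 by rewrite divr_gt0.
have [d1 d10 Hx] := svds_near0 x e7.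
have [d2 d20 Hy] := svds_near0 y e7.
have m0 : 0 < Num.min d1 d2 by rewrite lt_min d10.
have [|h hd h0|nx [a [b [a0 ab bd xab]]]] :=
    @uniform_interval (fst \o p_) x (e / 7) 0 (Num.min d1 d2) e7 _ _ xcvg.
- by rewrite lexx.
- by apply: Hx; rewrite h0 (lt_le_trans hd)// ge_min lexx.
have [|h hd h0|ny [a' [b' [aa' ab' bb' yab]]]] :=
    @uniform_interval (snd \o p_) y (e / 7) a b e7 _ _ ycvg.
- by rewrite a0.
- by apply: Hy; rewrite h0 (lt_le_trans hd)// (le_trans bd)// ge_min lexx orbT.
have ba0 : 0 < (b' - a') / 2 by lra.
have [nx' Hnx] := xcvg _ e7.
have [ny' Hny] := ycvg _ e7.
have [ns _ Hns] := near_infty_natSinv_lt (PosNum ba0).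
pose n := maxn nx (maxn ny (maxn nx' (maxn ny' ns))).
have [/andP[s0 sn] xyn exy] := Ps n.
have {}sn : s_ n < (b' - a') / 2.
  by apply: lt_trans sn _; apply: Hns; rewrite /= !leq_max leqnn !orbT.
(* The midpoint leaves room on its left: h - s_ n still lies in the interval. *)
pose h := b' - (b' - a') / 2.
have hs0 : 0 <= h - s_ n by rewrite /h; lra.
have [z yz] := svds_nonempty Phi (p_ n).2 hs0.
have xz : Phi h (p_ n).1 z.
  by rewrite -(subrK (s_ n) h); exact: svds_comp yz.
have yz' : d y z <= e / 7 + e / 7.
  apply: (yab (h - s_ n) _ n) => //.
    by rewrite /h; lra.
  by rewrite !leq_max leqnn !orbT.
have xz' : d x z <= e / 7 + e / 7.
  apply: (xab h _ n) => //.
    by rewrite /h; lra.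
  by rewrite !leq_max leqnn.
have xn : d x (p_ n).1 < e / 7 by apply: Hnx; rewrite !leq_max leqnn !orbT.
have yn : d y (p_ n).2 < e / 7 by apply: Hny; rewrite !leq_max leqnn !orbT.
have := metric_triangle (p_ n).1 x (p_ n).2.
have := metric_triangle x z (p_ n).2.
have := metric_triangle z y (p_ n).2.
rewrite (metric_sym _ x) (metric_sym z y); lra.
Qed.
End svds_theory.

(** * Solutions in the space of continuous paths *)

Definition path_fun (R : realType) (M : metricType R) (y : path_space M) :
  R -> M := (y : continuousType R M).
Arguments path_fun {R M}.

Lemma closed_svds_graph (R : realType) (M : metricType R) (Phi : svds M) (t : R) :
  0 <= t -> closed [set p : M * M | Phi t p.1 p.2].
Proof.
move=> t0 [x y] clxy; suff : closure (Phi t x) y by exact: svds_closed.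
move=> B /(nbhs_ballP _ _).1[e /= e0 eB].
have e2 : 0 < e / 2 by lra.
have [delta delta0 H] := svds_near_space Phi x t0 e2.
have [|[a b] [/= ab [/= xa yb]]] := clxy (ball x delta `*` ball y (e / 2)).
  by exists (ball x delta, ball y (e / 2)) => //; split; exact: nbhsx_ballx.
move: xa yb; rewrite !ballEmdist/= => xa yb.
have [c xc bc] := H _ xa _ ab.
exists c; split=> //; apply: eB; rewrite ballEmdist/=.
by apply: le_lt_trans (metric_triangle _ b _) _; lra.
Qed.

Definition rational_solution (R : realType) (M : metricType R) (Phi : svds M)
    (x : {ptws rat -> M}) : Prop :=
  forall p q : rat, p <= q -> Phi (ratr (q - p)) (x p) (x q).

Section path_space_theory.
Context (R : realType) (M : pmetricType R) (Phi : svds M).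
Hypothesis compactM : compact [set: M].
Local Notation d := (@mdist R M).

Lemma path_fun_continuous (y : path_space M) : continuous (path_fun y).
Proof. exact: cts_fun. Qed.

Lemma solution_unif e : 0 < e -> exists2 delta, 0 < delta &
  forall z : R -> M, entire_solution Phi z ->
    forall s t, `|s - t| < delta -> d (z s) (z t) < e.
Proof.
move=> e0; have [delta delta0 H] := svds_uniform0 Phi compactM e0.
exists delta => // z zP s t; wlog st : s t / s <= t.
  move=> W; have [st|/ltW ts] := leP s t; first exact: W.
  by rewrite distrC metric_sym; exact: W.
rewrite distrC ger0_norm ?subr_ge0// => std.
by apply: H (zP _ _ st); rewrite subr_ge0 st.
Qed.

Lemma rational_solution_unif e : 0 < e -> exists2 delta, 0 < delta &
  forall x, rational_solution Phi x ->
    forall p q, `|ratr p - ratr q : R| < delta -> d (x p) (x q) < e.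
Proof.
move=> e0; have [delta delta0 H] := svds_uniform0 Phi compactM e0.
exists delta => // x xP p q; wlog pq : p q / p <= q.
  move=> W; have [pq|/ltW qp] := leP p q; first exact: W.
  by rewrite distrC metric_sym; exact: W.
rewrite distrC -rmorphB ger0_norm ?ler0q ?subr_ge0// => pqd.
by apply: H (xP _ _ pq); rewrite ler0q subr_ge0 pq.
Qed.

Lemma extension_point (x : rat -> M) (t : R) :
  exists z, forall r, 0 < r -> exists q : rat, `|t - ratr q| < r /\ d z (x q) < r.
Proof.
pose B (r : R) := [set p : M * M | exists q : rat, `|t - ratr q| < r /\ p = (x q, x q)].
have [r r0|r r' r0 rr' p [q [qr ->]]|z [z' zP]] := @compact_cluster_pair _ M compactM B.
- have [q] := @rat_in_itvoo R (t - r) (t + r) ltac:(lra).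
  rewrite in_itv/= => /andP[q1 q2]; exists (x q, x q), q; split=> //.
  by rewrite ltr_norml; lra.
- by exists q; split => //; exact: lt_le_trans rr'.
- by exists z => r /zP[_ [[q [qr ->]] zq _]]; exists q.
Qed.

(** The extension takes as value at [t] any limit point of [x] at rationals
    tending to [t]; equicontinuity makes it a genuine limit. For the transition
    from [s] to [t], approach [s] from the left and [t] from the right: the
    rational time lag then exceeds [t - s] by a small amount, absorbed by
    continuity at time zero. The default value outside of the set of rational
    solutions makes the extension Borel. *)
Lemma rational_extension (x : {ptws rat -> M}) : exists y : path_space M,
  (rational_solution Phi x ->
    solutions Phi y /\ forall q, path_fun y (ratr q) = x q) /\
  (~ rational_solution Phi x -> y = point).
Proof.
have [xP|nx] := pselect (rational_solution Phi x); last by exists point.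
have /choice[z zP] := extension_point x.
have near_z e : 0 < e -> exists2 delta, 0 < delta &
    forall t q, `|t - ratr q| < delta -> d (z t) (x q) < e.
  move=> e0; have e2 : 0 < e / 2 by lra.
  have [delta delta0 H] := rational_solution_unif e2.
  exists (delta / 2); first by lra.
  move=> t q tq; have r0 : 0 < Num.min (delta / 2) (e / 2).
    by rewrite lt_min e2 andbT; lra.
  have [q' []] := zP t _ r0; rewrite !lt_min => /andP[tq' _] /andP[_ zq'].
  apply: le_lt_trans (metric_triangle _ (x q') _) _.
  rewrite [e]splitr ltrD//; apply: H => //.
  apply: le_lt_trans (ler_distD t _ _) _.
  by rewrite [delta]splitr ltrD// distrC.
have near_rat (t r : R) : 0 < r -> exists q : rat, t < ratr q < t + r.
  move=> r0; have [q] := @rat_in_itvoo R t (t + r) ltac:(lra).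
  by rewrite in_itv; exists q.
have near_rat' (t r : R) : 0 < r -> exists q : rat, t - r < ratr q < t.
  move=> r0; have [q] := @rat_in_itvoo R (t - r) t ltac:(lra).
  by rewrite in_itv; exists q.
have cz : continuous z.
  move=> t; apply/cvg_ballP => e e0.
  have e2 : 0 < e / 2 by lra.
  have [delta delta0 H] := near_z _ e2.
  have d2 : 0 < delta / 2 by lra.
  have [q /andP[q1 q2]] := near_rat t _ d2.
  have : \forall s \near t, `|t - s| < delta / 2.
    exact: (@cvgr_dist_lt _ R^o _ (nbhs t) _ id t cvg_id _ d2).
  apply: filterS => s ts; rewrite ballEmdist/=.
  apply: le_lt_trans (metric_triangle _ (x q) _) _.
  rewrite [e]splitr ltrD//; first by apply: H; rewrite ltr_norml; lra.
  rewrite metric_sym; apply: H; move: ts; rewrite !ltr_norml; lra.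
exists (mkcts cz : continuousType R M); split=> [_|//].
split=> [s t st|q]; last first.
  apply/eqP/negPn; rewrite -mdist_gt0 -leNgt; apply/ler_addgt0Pl => e e0.
  rewrite addr0; have [delta delta0 H] := near_z _ e0.
  by apply/ltW/H; rewrite subrr normr0.
have ts0 : 0 <= t - s by rewrite subr_ge0.
suff : closure (Phi (t - s) (z s)) (z t) by exact: svds_closed.
move=> B Bt.
have [e /= e0 eB] := (nbhs_ballP _ _).1 Bt.
have e3 : 0 < e / 3 by lra.
have [d1 d10 Hs] := svds_near_space Phi (z s) ts0 e3.
have [d2 d20 Hz] := near_z _ e3.
have [d3 d30 Hz1] := near_z _ d10.
have [d4 d40 Hu] := svds_uniform0 Phi compactM e3.
pose r := Num.min d2 (Num.min d3 (d4 / 2)).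
have r0 : 0 < r by rewrite !lt_min d20 d30; lra.
have [q /andP[tq1 tq2]] := near_rat t _ r0.
have [p /andP[sp1 sp2]] := near_rat' s _ r0.
have rd2 : r <= d2 by rewrite ge_min lexx.
have rd3 : r <= d3 by rewrite !ge_min lexx orbT.
have rd4 : r <= d4 / 2 by rewrite !ge_min lexx !orbT.
have pq : p <= q by rewrite -(ler_rat R); lra.
have := xP _ _ pq; rewrite rmorphB.
have -> : ratr q - ratr p = (ratr q - ratr p - (t - s)) + (t - s) :> R by lra.
have u0 : 0 <= ratr q - ratr p - (t - s) by lra.
move=> /(svds_decomp ts0 u0)[w pw wq].
have [|b sb wb] := Hs (x p) _ _ pw.
  by apply: Hz1; rewrite ltr_norml; lra.
exists b; split=> //; apply: eB; rewrite ballEmdist /=.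
have tq3 : d (z t) (x q) < e / 3 by apply: Hz; rewrite ltr_norml; lra.
have wq3 : d w (x q) < e / 3 by apply: Hu wq; lra.
have := metric_triangle (z t) (x q) b; have := metric_triangle (x q) w b.
rewrite (metric_sym (x q) w); lra.
Qed.

Lemma solutions_rational (y : path_space M) : solutions Phi y ->
  rational_solution Phi (fun q => path_fun y (ratr q)).
Proof. by move=> yP p q pq; rewrite rmorphB; apply: yP; rewrite ler_rat. Qed.

Lemma path_space_cvg (F : set_system (path_space M)) (y : path_space M) :
  Filter F ->
  (path_fun @ F --> (path_fun y : {family compact, R -> M})) -> F --> y.
Proof.
move=> FF Fy A; rewrite nbhsE => -[_ [[C oC <-] Cy] CA].
have FC : F (path_fun @^-1` C).
  by apply: Fy; rewrite nbhsE; exists C.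
by apply: filterS FC => w Cw; exact: CA.
Qed.

Lemma path_fun_cvg (y : path_space M) :
  path_fun @ nbhs y --> (path_fun y : {family compact, R -> M}).
Proof.
exact: (@initial_continuous (continuousType R M) {family compact, R -> M}
  (fun y => y : R -> M) y).
Qed.

Lemma path_eval_continuous (t : R) :
  continuous (fun y : path_space M => path_fun y t).
Proof.
move=> y; have FF : Filter (path_fun @ nbhs y) by exact: fmap_filter.
have := pointwise_cvg_compact_family FF (@path_fun_cvg y).
by move/(pointwise_cvgP (F := path_fun @ nbhs y)); exact.
Qed.

Lemma translate_path_continuous (t : R) : continuous (@translate R M t).
Proof.
move=> y.
have F0 : Filter (translate t @ nbhs y) by exact: fmap_filter.
have FF : Filter (path_fun @ (translate t @ nbhs y)) by exact: fmap_filter.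
apply: (path_space_cvg F0).
apply: ((fam_cvgP compact (path_fun (translate t y)) FF).2 _) => A cA U.
rewrite uniform_nbhs => -[E [entE EU]].
have cB : compact ((fun s => t + s) @` A).
  apply: continuous_compact => //; apply: continuous_subspaceT => s.
  by apply: cvgD; [exact: cvg_cst|exact: cvg_id].
have F1 : Filter (path_fun @ nbhs y) by exact: fmap_filter.
have := (fam_cvgP compact (path_fun y) F1).1 (@path_fun_cvg y) _ cB.
pose W := [set h | forall s, ((fun s => t + s) @` A) s -> E (path_fun y s, h s)].
move=> /(_ W) yW.
have {yW} : nbhs y (path_fun @^-1` W).
  by apply: yW; rewrite uniform_nbhs; exists E; split.
move=> yW; have yU : nbhs y (translate t @^-1` (path_fun @^-1` U)).
  apply: filterS yW => w /= yw.
  by apply: EU => s As; apply: yw; exists s.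
exact: yU.
Qed.

Lemma closed_solutions : closed (solutions Phi).
Proof.
have -> : solutions Phi = \bigcap_(st in [set st : R * R | st.1 <= st.2])
   ((fun y => (path_fun y st.1, path_fun y st.2)) @^-1`
    [set p : M * M | Phi (st.2 - st.1) p.1 p.2]).
  rewrite eqEsubset; split=> y; first by move=> yP [s t] /= st; exact: yP.
  by move=> yP s t st; exact: (yP (s, t)).
apply: closed_bigI => -[s t] /= st.
pose ev (y : path_space M) := (path_fun y s, path_fun y t).
have cev : continuous ev.
  move=> y; apply: (@cvg_pair _ _ _ (nbhs y)).
    exact: (@path_eval_continuous s y).
  exact: (@path_eval_continuous t y).
have st0 : 0 <= t - s by rewrite subr_ge0.
exact: ((continuous_closedP ev).1 cev _ (@closed_svds_graph R M Phi _ st0)).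
Qed.

(** Pointwise convergence suffices because solutions are equicontinuous. *)
Lemma solutions_cvg (F : set_system (path_space M)) (y : path_space M) :
  ProperFilter F -> F (solutions Phi) ->
  (forall t, path_fun w t @[w --> F] --> path_fun y t) -> F --> y.
Proof.
move=> PF FS Fy; apply: path_space_cvg.
have PFf : ProperFilter (path_fun @ F) by exact: fmap_proper_filter.
apply/(pointwise_compact_cvg (F := path_fun @ F)); last first.
  by apply/pointwise_cvgP => t; exact: Fy.
apply/near_powerset_filter_fromP.
  by move=> V W VW; exact: equicontinuous_subset_id.
exists [set z | entire_solution Phi z].
  by apply: filterS FS => w.
move=> t E; rewrite -entourage_ballE => -[e /= e0 eE].
have [delta delta0 H] := solution_unif e0.
have : \forall s \near t, `|t - s| < delta.
  exact: (@cvgr_dist_lt _ R^o _ (nbhs t) _ id t cvg_id _ delta0).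
apply: filterS => s ts z zP; apply: eE => /=; rewrite ballEmdist/=.
exact: H.
Qed.

End path_space_theory.

(** * Solutions over the rationals *)

Lemma ptws_eval_continuous (I : eqType) (T : topologicalType) (i : I) :
  continuous (fun x : {ptws I -> T} => x i).
Proof. exact: (@proj_continuous I (fun=> T) i). Qed.

Lemma ptws_cvg (I : eqType) (T : topologicalType)
    (F : set_system {ptws I -> T}) (x : {ptws I -> T}) : Filter F ->
  (forall i, (fun y : {ptws I -> T} => y i) @ F --> x i) -> F --> x.
Proof.
move=> FF Fx; apply/cvg_sup => i A; rewrite nbhsE => -[_ [[B oB <-] Bx] BA].
have FB : F ((fun y : {ptws I -> T} => y i) @^-1` B).
  by apply: (Fx i); exact: open_nbhs_nbhs.
by apply: filterS FB => y By; exact: BA.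
Qed.

Lemma ptws_continuous (I : eqType) (S T : topologicalType)
    (f : S -> {ptws I -> T}) :
  (forall i, continuous (fun s => f s i)) -> continuous f.
Proof.
move=> fc s; have Fs : Filter (f @ nbhs s) by exact: fmap_filter.
by apply: (ptws_cvg Fs) => i; exact: fc.
Qed.

(** A type of its own, so that the product topology and a base point are found
    by inference. *)
Definition rational_space (T : Type) : Type := {ptws rat -> T}.

HB.instance Definition _ (T : topologicalType) :=
  Topological.copy (rational_space T) {ptws rat -> T}.
HB.instance Definition _ (T : ptopologicalType) :=
  isPointed.Build (rational_space T) (fun=> point).

Lemma rational_eval_continuous (T : topologicalType) (q : rat) :
  continuous (fun x : rational_space T => x q).
Proof. exact: (@ptws_eval_continuous rat T q). Qed.

Lemma rational_space_compact (T : topologicalType) :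
  compact [set: T] -> compact [set: rational_space T].
Proof.
move=> cT; have := @tychonoff rat (fun=> T) (fun=> setT) (fun=> cT).
by congr compact; rewrite eqEsubset; split.
Qed.

Lemma rational_space_hausdorff (T : topologicalType) :
  hausdorff_space T -> hausdorff_space (rational_space T).
Proof. by move=> hT; exact: (@hausdorff_product rat (fun=> T)). Qed.

Definition rational_shift (T : Type) (r : rat) (x : rational_space T) :
  rational_space T := fun q => x (r + q).

Lemma countable_bigcup_nat (I : countType) (T : Type) (F : I -> set T) :
  exists2 G : (set T)^nat, \bigcup_i F i = \bigcup_n G n &
    forall n, (exists i, G n = F i) \/ G n = set0.
Proof.
exists (fun n => if unpickle n is Some i then F i else set0); last first.
  by move=> n; case: unpickle => [i|]; [left; exists i|right].
rewrite eqEsubset; split=> x [i _ Fx].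
  by exists (pickle i) => //; rewrite pickleK.
by move: Fx; case: unpickle => // i' Fx; exists i'.
Qed.

Definition transitions (R : realType) (M : metricType R) (Phi : svds M)
    (p q : rat) : set (rational_space M) :=
  [set x | Phi (ratr (q - p)) (x p) (x q)].

Section rational_solutions.
Context (R : realType) (M : pmetricType R) (Phi : svds M).
Hypothesis compactM : compact [set: M].
Local Notation d := (@mdist R M).
Local Notation Q := (rational_space M).

Lemma closed_transitions p q : p <= q -> closed (transitions Phi p q).
Proof.
move=> pq; pose ev (x : Q) := (x p, x q).
have cev : continuous ev.
  move=> x; apply: (@cvg_pair _ _ _ (nbhs x)).
    exact: (@rational_eval_continuous M p x).
  exact: (@rational_eval_continuous M q x).
have pq0 : 0 <= ratr (q - p) :> R by rewrite ler0q subr_ge0.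
exact: ((continuous_closedP ev).1 cev _ (@closed_svds_graph R M Phi _ pq0)).
Qed.

Let bad (pq : rat * rat) : set Q :=
  if pq.1 <= pq.2 then ~` transitions Phi pq.1 pq.2 else set0.

Let badE : ~` rational_solution Phi = \bigcup_pq bad pq.
Proof.
rewrite eqEsubset; split=> x.
  move=> nx; apply: contrapT => nb; apply: nx => p q pq; apply: contrapT => nxpq.
  apply: nb; exists (p, q); first by [].
  by rewrite /bad /= pq.
move=> [[p q] _]; rewrite /bad /=.
by case: ifPn => // pq nx xP; apply: nx; exact: xP.
Qed.

Let open_bad pq : open (bad pq).
Proof.
rewrite /bad; case: ifPn => [h|_]; last exact: open0.
exact/closed_openC/closed_transitions.
Qed.

Lemma rational_solution_borel :
  measurable (rational_solution Phi : set (borel Q)).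
Proof.
rewrite -(setCK (rational_solution Phi)).
apply: (@measurableC _ (borel Q)); rewrite badE; apply: open_borel.
by apply: bigcup_open => n _; exact: open_bad.
Qed.

Lemma rational_solution_negligible (la : borel_probability Q R) :
  (forall p q, p <= q -> la (~` transitions Phi p q) = 0%E) ->
  la (~` rational_solution Phi) = 0%E.
Proof.
move=> la0; apply: measure_negligible.
  by apply: (@measurableC _ (borel Q)); exact: rational_solution_borel.
have [G bG GP] := countable_bigcup_nat bad.
rewrite badE bG; apply: (@negligible_bigcup _ (borel Q)) => n.
have [[[p q] ->]| ->] := GP n; last exact: negligible_set0.
exists (bad (p, q)); split; [by apply: open_borel; exact: open_bad| |by []].
by rewrite /bad /=; case: ifPn => [pq|_]; [exact: la0|exact: measure0].
Qed.

(** The extension map is continuous on the set of rational solutions: by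
    equicontinuity, values at a real time are controlled by values at one nearby
    rational. It is constant outside of that set, which is Borel. *)
Lemma extension_borel : exists j : Q -> path_space M,
  [/\ measurable_fun [set: borel Q] (j : borel Q -> borel (path_space M)),
      forall x, rational_solution Phi x -> solutions Phi (j x)
    & forall x, rational_solution Phi x ->
        forall q, path_fun (j x) (ratr q) = x q].
Proof.
have /choice[j jP] := @rational_extension R M Phi compactM.
exists j; split=> [|x xP|x xP]; try by case: ((jP x).1 xP).
apply: (@measurability _ _ (borel Q) (borel (path_space M)) _ _ (@open _)) => //.
move=> _ [A oA <-]; rewrite setTI.
pose O := interior (j @^-1` A `|` ~` rational_solution Phi).
have -> : j @^-1` A = (rational_solution Phi `&` O) `|`
    (~` rational_solution Phi `&` [set _ | A point]).
  rewrite eqEsubset; split=> x /=.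
    move=> Ax; have [xP|nx] := pselect (rational_solution Phi x); last first.
      by right; split => //; rewrite -((jP x).2 nx).
    left; split=> //.
    pose F : set_system (path_space M) := j @ within (rational_solution Phi) (nbhs x).
    have PF : ProperFilter F.
      apply: fmap_proper_filter; apply: within_nbhs_proper.
      exact: subset_closure.
    suff : F --> j x.
      have nA : nbhs (j x) A by apply: open_nbhs_nbhs; split.
      move=> /(_ A nA) FA; rewrite /O /interior.
      have {}FA : nbhs x [set x' | rational_solution Phi x' -> A (j x')] by [].
      apply: filterS FA => x' x'A.
      have [|] := pselect (rational_solution Phi x'); [by left; exact: x'A|by right].
    apply: (@solutions_cvg R M Phi compactM) => [|t].
      have SF : nbhs x [set x' | rational_solution Phi x' -> solutions Phi (j x')].
        by apply: filterS filterT => x' _ x'P; case: ((jP x').1 x'P).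
      exact: SF.
    apply/cvg_ballP => e e0.
    have e3 : 0 < e / 3 by lra.
    have [delta delta0 H] := solution_unif Phi compactM e3.
    have [q] := @rat_in_itvoo R (t - delta) (t + delta) ltac:(lra).
    rewrite in_itv/= => /andP[tq1 tq2].
    have tq : `|t - ratr q| < delta by rewrite ltr_norml; lra.
    have : nbhs x ((fun x' : Q => x' q) @^-1` ball (x q) (e / 3)).
      by apply: (@rational_eval_continuous M q x); exact: nbhsx_ballx.
    move=> xq3; suff : nbhs x [set x' | rational_solution Phi x' ->
      ball (path_fun (j x) t) e (path_fun (j x') t)] by [].
    apply: filterS xq3 => x' /=.
    rewrite !ballEmdist /= => xx' x'P.
    have [sx xq] := (jP x).1 xP; have [sx' xq'] := (jP x').1 x'P.
    have := H _ sx _ _ tq; have := H _ sx' _ _ tq.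
    rewrite -/(path_fun _) -/(path_fun (j x)) -/(path_fun (j x')) xq xq'.
    move=> h1 h2; have := metric_triangle (path_fun (j x) t) (x q) (path_fun (j x') t).
    have := metric_triangle (x q) (x' q) (path_fun (j x') t).
    rewrite (metric_sym (x' q)) -/(path_fun _) -/(path_fun (j x)) -/(path_fun (j x')).
    lra.
  move=> [[xP Ox]|[nx Ap]]; last by rewrite ((jP x).2 nx).
  by have [//|] := interior_subset Ox.
apply: (@measurableU _ (borel Q)).
  apply: (@measurableI _ (borel Q)); first exact: rational_solution_borel.
  by apply: open_borel; exact: open_interior.
apply: (@measurableI _ (borel Q)).
  by apply: (@measurableC _ (borel Q)); exact: rational_solution_borel.
have [Ap|nAp] := pselect (A point).
  have -> : [set _ : Q | A point] = setT by rewrite eqEsubset; split.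
  exact: (@measurableT _ (borel Q)).
have -> : [set _ : Q | A point] = set0 by rewrite eqEsubset; split.
exact: (@measurable0 _ (borel Q)).
Qed.
End rational_solutions.

(** * From finitely additive to translation-invariant measures *)

Section translation_invariance.
Context (R : realType) (M : pmetricType R) (Phi : svds M).
Hypothesis compactM : compact [set: M].
Local Notation P := (path_space M).

Lemma translateD (s t : R) (y : P) :
  translate s (translate t y) = translate (t + s) y.
Proof. by apply/continuousEP => u /=; rewrite /translate /= /mkcts addrA. Qed.

Lemma translate0 (y : P) : translate 0 y = y.
Proof. by apply/continuousEP => u /=; rewrite /translate /= /mkcts add0r. Qed.

Lemma translate_solution (t : R) (y : P) :
  solutions Phi y -> solutions Phi (translate t y).
Proof.
move=> yP u v uv.
have := yP (t + u) (t + v); rewrite lerD2l => /(_ uv).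
by rewrite opprD addrACA subrr add0r.
Qed.

(** For a solution [y], translates of [y] by rationals tending to [t] tend to
    its translate by [t], so an open set containing the latter eventually
    contains the former; rational invariance thus passes to all times, as an
    inequality on open sets that reverses under the opposite translation. *)
Lemma rational_translation_invariant (nu : borel_probability P R) :
  nu (~` solutions Phi) = 0%E ->
  (forall (r : rat) (A : set P), open A ->
    nu (translate (ratr r) @^-1` A) = nu A) ->
  forall (t : R) (A : set (borel P)), measurable A ->
    nu (translate t @^-1` A) = nu A.
Proof.
move=> nuS nur.
have mS : measurable (~` solutions Phi : set (borel P)).
  by apply: open_borel; apply: closed_openC; exact: closed_solutions.
have otr t (A : set P) : open A -> open (translate t @^-1` A).
  by move=> oA; move/continuousP: (@translate_path_continuous R M t); exact.
have le_tr t (A : set P) : open A -> (nu (translate t @^-1` A) <= nu A)%E.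
  move=> oA.
  have /choice[r_ rP] (n : nat) : exists r : rat, `|t - ratr r| < n.+1%:R^-1.
    have : 0 < n.+1%:R^-1 :> R by rewrite invr_gt0.
    move: (n.+1%:R^-1) => e e0.
    have [q] := @rat_in_itvoo R (t - e) (t + e) ltac:(lra).
    by rewrite in_itv/= => /andP[? ?]; exists q; rewrite ltr_norml; lra.
  pose A_ n : set (borel P) := translate (ratr (r_ n)) @^-1` A.
  have mA n : measurable (A_ n) by apply: open_borel; exact: otr.
  pose B n := \bigcap_(k in [set k | (n <= k)%N]) A_ k.
  have mB n : measurable (B n) by apply: bigcap_measurableType => k _; exact: mA.
  have mUB : measurable (\bigcup_n B n) by exact: bigcupT_measurable.
  apply: (@le_trans _ _ (nu (\bigcup_n B n))).
    apply: (@le_measure_null _ (borel P) R nu _ _ (~` solutions Phi)) => //.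
      by apply: open_borel; exact: otr.
    move=> y Ay; have [yP|] := pselect (solutions Phi y); last by right.
    left; pose F : set_system P := (fun n => translate (ratr (r_ n)) y) @ \oo.
    have rt : ratr (r_ n) @[n --> \oo] --> t.
      apply/cvgrPdist_lt => e e0.
      have [n _ ne] := near_infty_natSinv_lt (PosNum e0).
      by exists n => // m nm; apply: lt_trans (rP m) _; exact: ne.
    have : F --> translate t y.
      apply: (@solutions_cvg R M Phi compactM) => [|s].
        by exists 0 => // n _; exact: translate_solution.
      apply: (@cvg_comp _ _ _ (fun n : nat => ratr (r_ n) + s) (path_fun y) _ (nbhs (t + s))).
        by apply: cvgD => //; exact: cvg_cst.
      exact: (@path_fun_continuous R M y (t + s)).
    move=> /(_ A (open_nbhs_nbhs (conj oA Ay))) [n _ nA].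
    by exists n => // k /= nk; exact: nA.
  have ndB : {homo B : n m / (n <= m)%N >-> (n <= m)%O}.
    move=> n m nm; apply/subsetPset => y Bny k /= mk; apply: Bny => /=.
    exact: leq_trans mk.
  have := nondecreasing_cvg_mu (mu := nu) mB mUB ndB.
  move=> nuB; rewrite -(cvg_lim _ nuB)//.
  apply: lime_le; first by apply/cvg_ex; exists (nu (\bigcup_n B n)).
  apply: nearW => n /=; rewrite -(nur (r_ n) A oA).
  apply: le_measure; rewrite ?inE//; first exact: mA.
  by move=> y; apply => /=.
move=> t A mA.
have [nut nutE] := image_probability nu (continuous_borel (@translate_path_continuous R M t)).
rewrite -nutE; apply: eq_borel_measure mA => V oV; rewrite nutE.
apply/eqP; rewrite eq_le le_tr//=.
have := le_tr (- t) (translate t @^-1` V) (otr t V oV).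
congr (nu _ <= _)%E; rewrite eqEsubset; split=> y /=;
  by rewrite translateD addNr translate0.
Qed.

End translation_invariance.

Section invariant_lift.
Context (R : realType) (M : pmetricType R) (Phi : svds M).
Hypothesis compactM : compact [set: M].
Local Notation Q := (rational_space M).
Local Notation P := (path_space M).

Lemma rational_shift_continuous r : continuous (@rational_shift M r).
Proof.
apply: (@ptws_continuous rat Q M _) => q.
exact: (@rational_eval_continuous M (r + q)).
Qed.

Lemma rational_shift_solution r x :
  rational_solution Phi x -> rational_solution Phi (rational_shift r x).
Proof.
move=> xP p q pq; have := xP (r + p) (r + q).
by rewrite lerD2l => /(_ pq); rewrite opprD addrACA subrr add0r.
Qed.

Lemma solution_rational_eq (y z : P) : solutions Phi y -> solutions Phi z ->
  (forall q, path_fun y (ratr q) = path_fun z (ratr q)) -> y = z.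
Proof.
move=> yP zP yz; apply/continuousEP => t.
apply/eqP/negPn; rewrite -mdist_gt0 -leNgt; apply/ler_addgt0Pl => e e0.
rewrite addr0; have e2 : 0 < e / 2 by lra.
have [delta delta0 H] := solution_unif Phi compactM e2.
have [q] := @rat_in_itvoo R (t - delta) (t + delta) ltac:(lra).
rewrite in_itv/= => /andP[tq1 tq2].
have tq : `|t - ratr q| < delta by rewrite ltr_norml; lra.
have h1 : mdist (path_fun y t) (path_fun y (ratr q)) < e / 2 := H _ yP _ _ tq.
have h2 : mdist (path_fun z t) (path_fun z (ratr q)) < e / 2 := H _ zP _ _ tq.
rewrite -yz metric_sym in h2.
apply: le_trans (metric_triangle _ (path_fun y (ratr q)) _) _.
by rewrite [e]splitr; exact: lerD (ltW h1) (ltW h2).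
Qed.

(** The measure is the image, under extension to entire solutions, of the regular
    part of [m]. Translation by [r] permutes the closed sets of functions
    over the rationals, so the regular part is invariant on open sets, hence on Borel sets;
    and translation commutes with extension on rational solutions. *)
Theorem invariant_lift (m : set Q -> R) : finitely_additive m ->
  (forall p q, p <= q -> m (transitions Phi p q) = 1) ->
  (forall r (A : set (borel Q)), 0 <= r -> measurable A ->
    m (rational_shift r @^-1` A) = m A) ->
  exists nu : borel_probability P R,
    [/\ nu (~` solutions Phi) = 0%E,
        forall t (A : set (borel P)), measurable A ->
          nu (translate t @^-1` A) = nu A
      & forall V : set M, open V ->
          (nu (@path_eval0 R M @^-1` V) <= (m [set x | V (x 0)])%:E)%E].
Proof.
move=> mP mtr mshift0.
have shiftK r : cancel (@rational_shift M r) (rational_shift (- r)).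
  by move=> x; apply/funext => q; rewrite /rational_shift addrA subrr add0r.
have msh r B : measurable (B : set (borel Q)) ->
    measurable (rational_shift r @^-1` B : set (borel Q)).
  move=> mB; have := continuous_borel (@rational_shift_continuous r).
  by move=> /(_ measurableT B mB); rewrite setTI.
have mshift r (A : set (borel Q)) : measurable A ->
    m (rational_shift r @^-1` A) = m A.
  move=> mA; have [/mshift0|r0] := leP 0 r; first exact.
  rewrite -(@mshift0 (- r)) ?oppr_ge0 ?ltW//; last exact: msh.
  congr m; rewrite eqEsubset; split=> x /=;
    by rewrite -{1}(opprK r) shiftK.
have cQ : compact [set: Q] by exact: rational_space_compact.
have hQ : hausdorff_space Q.
  by apply: rational_space_hausdorff; exact: metric_hausdorff.
have [la laE] := regular_part mP hQ cQ.
have la_le V : open V -> (la V <= (m V)%:E)%E.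
  by move=> oV; rewrite laE// inner_mass_le.
have oshift r V : open V -> open (@rational_shift M r @^-1` V).
  by move=> oV; move/continuousP: (@rational_shift_continuous r); exact.
have la_shift_le r V : open V -> (la (rational_shift r @^-1` V) <= la V)%E.
  move=> oV; rewrite laE ?laE//; last exact: oshift.
  apply: ge_ereal_sup => _ [F [cF FV] <-].
  rewrite -(mshift (- r)); last exact: closed_borel.
  apply: inner_mass_ge.
    by move/continuous_closedP: (@rational_shift_continuous (- r)); exact.
  by move=> x /= /FV /=; rewrite -{1}(opprK r) shiftK.
have la_shift r V : open V -> la (rational_shift r @^-1` V) = la V.
  move=> oV; apply/eqP; rewrite eq_le la_shift_le//=.
  have := la_shift_le (- r) _ (oshift r V oV).
  congr (la _ <= _)%E; rewrite eqEsubset; split=> x /=;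
    by rewrite -{1}(opprK r) shiftK.
have la_sol : la (~` rational_solution Phi) = 0%E.
  apply: rational_solution_negligible => p q pq.
  have oC : open (~` transitions Phi p q).
    exact/closed_openC/closed_transitions.
  apply/eqP; rewrite eq_le measure_ge0 andbT.
  apply: le_trans (la_le _ oC) _.
  rewrite fa_setC ?mtr ?subrr//.
  by apply: (@closed_borel Q); exact: closed_transitions.
have mN : measurable (~` rational_solution Phi : set (borel Q)).
  by apply: (@measurableC _ (borel Q)); exact: rational_solution_borel.
have [j [mj jS jE]] := extension_borel Phi compactM.
have [nu nuE] := image_probability la mj.
have mjA A : measurable (A : set (borel P)) -> measurable (j @^-1` A : set (borel Q)).
  by move=> mA; have := mj measurableT A mA; rewrite setTI.
have nuS : nu (~` solutions Phi) = 0%E.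
  rewrite nuE; apply/eqP; rewrite eq_le measure_ge0 andbT -la_sol.
  apply: le_measure; rewrite ?inE//.
    apply: mjA; apply: open_borel; apply: closed_openC; exact: closed_solutions.
  by move=> x nx xP; apply: nx; exact: jS.
exists nu; split => //.
  apply: (rational_translation_invariant compactM nuS) => r A oA.
  rewrite !nuE.
  have jsh x : rational_solution Phi x ->
      translate (ratr r) (j x) = j (rational_shift r x).
    move=> xP; have sxP := rational_shift_solution r xP.
    apply: solution_rational_eq; first exact/translate_solution/jS.
      exact: jS.
    by move=> q; rewrite (jE _ sxP) /path_fun /= /mkcts -rmorphD; exact: jE.
  have mtrA : measurable (j @^-1` (translate (ratr r) @^-1` A) : set (borel Q)).
    apply: mjA; apply: open_borel.
    by move/continuousP: (@translate_path_continuous R M (ratr r)); exact.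
  have mjAA : measurable (j @^-1` A : set (borel Q)) by apply: mjA; exact: open_borel.
  transitivity (la (rational_shift r @^-1` (j @^-1` A))).
    apply/eqP; rewrite eq_le; apply/andP; split;
    apply: (@le_measure_null _ (borel Q) R la _ _ (~` rational_solution Phi)) => //; try exact: msh.
      move=> x /=; have [xP|] := pselect (rational_solution Phi x); last by right.
      by rewrite jsh//; left.
    move=> x /=; have [xP|] := pselect (rational_solution Phi x); last by right.
    by rewrite -jsh//; left.
  have [la' la'E] := image_probability la (continuous_borel (@rational_shift_continuous r)).
  rewrite -la'E; apply: eq_borel_measure mjAA => V oV.
  by rewrite la'E la_shift.
move=> V oV; rewrite nuE.
have oV0 : open [set x : Q | V (x 0)].
  by move/continuousP: (@rational_eval_continuous M 0); exact.
apply: le_trans (la_le _ oV0).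
apply: (@le_measure_null _ (borel Q) R la _ _ (~` rational_solution Phi)) => //.
- apply: mjA; apply: open_borel.
  by move/continuousP: (@path_eval_continuous R M 0); exact.
- exact: open_borel.
- move=> x /=; have [xP|] := pselect (rational_solution Phi x); last by right.
  by have := jE x xP 0; rewrite rmorph0 => <-; left.
Qed.

End invariant_lift.

(** * Ultralimits of probabilities *)

Lemma ultra_fmap (I J : Type) (f : I -> J) (U : set_system I) :
  UltraFilter U -> UltraFilter (f @ U).
Proof.
move=> UU; apply: Build_UltraFilter => G PG UG.
rewrite eqEsubset; split=> // A GA.
have [//|UnA] := in_ultra_setVsetC (f @^-1` A) UU.
have GnA : G (~` A) by exact: UG.
by have [x []] := filter_ex (filterI GA GnA).
Qed.

Lemma le_cvg_filter (R : realType) (I : Type) (F : set_system I)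
    {PF : ProperFilter F} (f g : I -> R) (a b : R) :
  f i @[i --> F] --> a -> g i @[i --> F] --> b ->
  (\forall i \near F, f i <= g i) -> a <= b.
Proof.
move=> fa gb fg; rewrite -subr_ge0; have ba : g i - f i @[i --> F] --> b - a by exact: cvgB.
rewrite -(cvg_lim _ ba)//; apply: limr_ge.
  by apply/cvg_ex; eexists; exact: ba.
by apply: filterS fg => i fgi /=; rewrite subr_ge0.
Qed.

Section ultralimit.
Context (R : realType) (I : Type) (U : set_system I) {FU : UltraFilter U}.
Implicit Types f g : I -> R.

(** Meaningful when [f] is eventually bounded, by [cvg_ulim]. *)
Definition ulim f : R := lim (f i @[i --> U]).

Lemma ulim_eq f l : f i @[i --> U] --> l -> ulim f = l.
Proof. exact: cvg_lim. Qed.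

Lemma cvg_ulim f a b : (\forall i \near U, a <= f i <= b) ->
  f i @[i --> U] --> ulim f.
Proof.
move=> ab; have cab : compact (`[a, b] : set R) by exact: segment_compact.
rewrite compact_ultra in cab.
have [||l [_ fl]] := cab (f @ U); first exact: ultra_fmap.
  by apply: filterS ab => i /=; rewrite in_itv.
by rewrite (ulim_eq fl).
Qed.

Lemma ulim_near f c : (\forall i \near U, f i = c) -> ulim f = c.
Proof.
move=> fc; apply: ulim_eq; apply: cvg_near_cst; exact: fc.
Qed.

Lemma eq_ulim f g : (\forall i \near U, f i = g i) -> ulim f = ulim g.
Proof.
have le_ulim h k : (\forall i \near U, h i = k i) -> h @ U `<=` k @ U.
  by move=> hk A hA; apply: filterS2 hk hA => i /= ->.
move=> fg; rewrite /ulim; congr (lim _); rewrite eqEsubset; split.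
  exact: le_ulim.
by apply: le_ulim; apply: filterS fg => i ->.
Qed.

Lemma ulim_asymptotic f g a b :
  (\forall i \near U, a <= g i <= b) ->
  (f i - g i) @[i --> U] --> (0 : R) -> ulim f = ulim g.
Proof.
move=> gab fg; apply: ulim_eq.
have fE : f = (fun i => (f i - g i) + g i) by apply/funext => i; rewrite subrK.
by rewrite fE -[ulim g]add0r; apply: cvgD fg (cvg_ulim gab).
Qed.

(** Only finite additivity survives: countable sums do not commute with the
    limit. *)
Lemma fa_ulim (T : ptopologicalType) (m_ : I -> set T -> R) :
  (\forall i \near U, finitely_additive (m_ i)) ->
  finitely_additive (fun A => ulim (fun i => m_ i A)).
Proof.
move=> mP.
have cm (A : set (borel T)) : measurable A ->
    m_ i A @[i --> U] --> ulim (fun i => m_ i A).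
  move=> mA; apply: (@cvg_ulim _ 0 1); apply: filterS mP => i iP.
  by rewrite (fa_ge0 iP mA) (fa_le1 iP mA).
split=> [|A mA|A B mA mB AB].
- by apply: ulim_near; apply: filterS mP => i iP; exact: fa_setT.
- apply: limr_ge; first by apply/cvg_ex; eexists; exact: cm.
  by apply: filterS mP => i iP; exact: fa_ge0.
- apply: ulim_eq; apply: cvg_trans (cvgD (cm _ mA) (cm _ mB)).
  apply: near_eq_cvg.
  by apply: filterS mP => i iP /=; rewrite fa_setU.
Qed.

End ultralimit.

Lemma exists_ultrafilter_nat : exists2 U : set_system nat, UltraFilter U &
  forall P : set nat, (\forall n \near \oo, P n) -> U P.
Proof.
have [U [UU oU]] := @ultraFilterLemma nat \oo _.
by exists U => // P; exact: oU.
Qed.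

Lemma fa_probability (R : realType) (T : ptopologicalType)
    (mu : borel_probability T R) : finitely_additive (fun A => fine (mu A)).
Proof.
split=> [|A mA|A B mA mB AB].
- by have -> : mu setT = 1%E := probability_setT mu.
- exact/fine_ge0/measure_ge0.
- by rewrite measureU// fineD// fin_num_measure.
Qed.

Lemma fa_preimage (R : realType) (S T : ptopologicalType) (m : set S -> R)
    (f : S -> T) :
  measurable_fun [set: borel S] (f : borel S -> borel T) ->
  finitely_additive m -> finitely_additive (fun A => m (f @^-1` A)).
Proof.
move=> mf mP.
have mfA (A : set (borel T)) : measurable A ->
    measurable (f @^-1` A : set (borel S)).
  by move=> mA; have := mf measurableT A mA; rewrite setTI.
split=> [|A mA|A B mA mB AB].
- by rewrite preimage_setT (fa_setT mP).
- by rewrite (fa_ge0 mP)//; exact: mfA.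
- rewrite preimage_setU (fa_setU mP)//; try exact: mfA.
  by rewrite -preimage_setI AB preimage_set0.
Qed.

Lemma fa_count (R : realType) (T : ptopologicalType) (x : nat -> T) (N : nat) :
  (0 < N)%N ->
  finitely_additive (fun A => N%:R^-1 * \sum_(k < N) (\1_A (x k) : R)).
Proof.
move=> N0; split=> [|A _|A B _ _ AB].
- under eq_bigr do rewrite indicT.
  rewrite sumr_const card_ord mulVf// pnatr_eq0.
  by rewrite -lt0n.
- rewrite mulr_ge0 ?invr_ge0// sumr_ge0// => k _.
- rewrite -mulrDr -big_split; congr (_ * _); apply: eq_bigr => k _ /=.
  rewrite !indicE in_setU; have [Ax|_] := boolP (x k \in A); last by rewrite add0r.
  have [Bx|_] := boolP (x k \in B); last by rewrite addr0.
  have : (A `&` B) (x k) by split; exact: set_mem.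
  by rewrite AB.
Qed.

(** * Domination on open sets and weak convergence *)

(** An open set is the increasing union of the closed sets of points at
    distance at least [1/n] from its complement. Complementation reverses the
    domination on these closed sets, and monotone limits reverse it on the open
    set. *)
Lemma open_dominated_eq (R : realType) (M : pmetricType R)
    (mu nu : borel_probability M R) :
  (forall V : set M, open V -> (nu V <= mu V)%E) ->
  forall A : set (borel M), measurable A -> nu A = mu A.
Proof.
move=> numu; apply: eq_borel_measure => V oV.
apply/eqP; rewrite eq_le numu//=.
have mV : measurable (V : set (borel M)) by exact: open_borel.
pose G (n : nat) := [set x : M | forall y, ~ V y -> n.+1%:R^-1 <= mdist x y].
have cG n : closed (G n).
  move=> x clx y nVy; rewrite leNgt; apply/negP => xy.
  have r0 : 0 < n.+1%:R^-1 - mdist x y by rewrite subr_gt0.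
  have [z [Gz]] := clx _ (nbhsx_ballx _ _ r0); rewrite ballEmdist/= => xz.
  have := Gz _ nVy; have := metric_triangle z x y; rewrite (metric_sym z x).
  move: xz; move: (n.+1%:R^-1) => e; lra.
have mG n : measurable (G n : set (borel M)) by exact: closed_borel.
have GV n : G n `<=` V.
  move=> x Gx; apply: contrapT => /Gx; rewrite mdistxx leNgt.
  by rewrite invr_gt0 ltr0Sn.
have -> : V = \bigcup_n G n.
  rewrite eqEsubset; split=> [x Vx|x [n _]]; last exact: GV.
  have : nbhs x V by exact: open_nbhs_nbhs.
  move=> /(nbhs_ballP _ _).1[e /= e0 eV].
  have [n _ ne] := near_infty_natSinv_lt (PosNum e0).
  exists n => // y nVy; rewrite leNgt; apply/negP => xy; apply: nVy; apply: eV.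
  by rewrite ballEmdist/=; apply: lt_trans xy _; exact: ne (leqnn n).
have ndG : {homo G : n m / (n <= m)%N >-> (n <= m)%O}.
  move=> n m nm; apply/subsetPset => x Gx y nVy; apply: le_trans (Gx y nVy).
  by rewrite lef_pV2 ?posrE ?ltr0Sn// ler_nat.
have mUG : measurable (\bigcup_n G n : set (borel M)) by exact: bigcupT_measurable.
have muG := nondecreasing_cvg_mu (mu := mu) mG mUG ndG.
rewrite -(cvg_lim _ muG)//; apply: lime_le.
  by apply/cvg_ex; eexists; exact: muG.
apply: nearW => n /=; apply: (@le_trans _ _ (nu (G n))); last first.
  apply: le_measure; rewrite ?inE// => x Gx.
  by exists n.
have oC : open (~` G n) by exact: closed_openC.
have := numu _ oC.
have mC : measurable (~` G n : set (borel M)) by exact: open_borel.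
rewrite [leLHS](@probability_setC _ (borel M))// [leRHS](@probability_setC _ (borel M))//.
rewrite -(fineK (fin_num_measure nu _ (mG n))) -(fineK (fin_num_measure mu _ (mG n))).
by rewrite -!EFinB !lee_fin; lra.
Qed.

Section portmanteau.
Context (R : realType) (T : ptopologicalType).
Implicit Types (mu : borel_probability T R) (f : T -> R).

Lemma continuous_borel_real f : continuous f ->
  measurable_fun [set: borel T] (f : borel T -> R).
Proof.
move=> cf; apply: (measurability _ (measurable_realfun.RGenOInfty.measurableE R)).
move=> _ [_ [a ->] <-]; rewrite setTI; apply: open_borel.
by move/continuousP: cf; apply; exact: interval_open.
Qed.

Lemma bounded_integrable mu f (B : R) :
  measurable_fun [set: borel T] (f : borel T -> R) ->
  (forall x, `|f x| <= B) ->
  mu.-integrable [set: borel T] (EFin \o f).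
Proof.
move=> mf fB; apply: measurable_bounded_integrable => //.
  by apply: le_lt_trans (probability_le1 mu measurableT) (ltry _).
exists B; split; first exact: num_real.
by move=> b Bb x _ /=; exact: le_trans (fB x) (ltW Bb).
Qed.

Lemma Rintegral_cst_probability mu (c : R) :
  Rintegral mu setT (fun=> c) = c.
Proof.
rewrite (Rintegral_cst mu (measurableT : measurable [set: borel T])).
rewrite -[RHS]mulr1; congr (c * _).
by transitivity (fine (1%E : \bar R)) => //; congr fine; exact: probability_setT.
Qed.

(** Lower Riemann sum, with step [h], of the layer-cake formula. *)
Definition layer_sum (m : set T -> R) f (h : R) (N : nat) : R :=
  h * \sum_(k < N) m [set x | k.+1%:R * h < f x].

Let stair f (h : R) N (x : T) : R :=
  \sum_(k < N) \1_[set x | k.+1%:R * h < f x] x.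

Let stair_le f h N x : stair f h N x <= N%:R.
Proof.
rewrite -[leRHS]mul1r mulr_natr -[N in leRHS]card_ord -sumr_const.
by apply: ler_sum => k _; rewrite indicE; case: (_ \in _).
Qed.

Let stair_lower f h N x : 0 <= h -> 0 <= f x -> h * stair f h N x <= f x.
Proof.
move=> h0 f0; elim: N => [|N IH]; first by rewrite /stair big_ord0 mulr0.
have := stair_le f h N.+1 x; rewrite {1 2}/stair big_ord_recr/= -/(stair f h N x).
rewrite indicE; have [/set_mem/= Nf|_] := boolP (_ \in _); last by rewrite addr0.
move=> sN; apply: le_trans (ltW Nf); rewrite mulrC.
by apply: ler_wpM2r.
Qed.

Let stair_upper f h N x : 0 <= h -> f x <= N.+1%:R * h ->
  f x <= h * stair f h N x + h.
Proof.
move=> h0; elim: N => [|N IH]; first by rewrite /stair big_ord0 mulr0 add0r mul1r.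
have [fN _|Nf] := leP (f x) (N.+1%:R * h).
  apply: le_trans (IH fN) _; rewrite lerD2r ler_wpM2l//.
  by rewrite /stair big_ord_recr/= lerDl.
rewrite mulrSr mulrDl mul1r => fN; apply: le_trans fN _; rewrite lerD2r mulrC.
rewrite ler_wpM2l// -[leLHS]mul1r mulr_natr -[N.+1 in leLHS]card_ord -sumr_const.
apply: ler_sum => k _; rewrite indicE mem_set//=.
by apply: le_lt_trans Nf; rewrite ler_wpM2r// ler_nat ltn_ord.
Qed.

Let level f : continuous f -> forall c, open [set x | c < f x].
Proof.
by move=> cf c; move/continuousP: cf => /(_ `]c, +oo[%classic); rewrite preimage_itvoy; apply; exact: interval_open.
Qed.

Let stair_integrable mu f h N : continuous f ->
  mu.-integrable [set: borel T] (EFin \o stair f h N).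
Proof.
move=> cf; elim: N => [|N IH].
  apply: (eq_integrable measurableT _ _ _ (integrable0 _ _)) => x _ /=.
  by rewrite /stair big_ord0.
have := integrableD measurableT IH (integrable_indic mu (open_borel (level cf (N.+1%:R * h)))).
apply: eq_integrable => // x _ /=.
by rewrite /stair big_ord_recr.
Qed.

Let Rintegral_stair mu f h N : continuous f ->
  (\int[mu]_(x in setT) (h * stair f h N x) =
    layer_sum (fun A => fine (mu A)) f h N)%R.
Proof.
move=> cf; rewrite RintegralZl//; last exact: stair_integrable.
congr (_ * _); elim: N => [|N IH].
  rewrite big_ord0 -[RHS](mul0r (fine (mu setT))) -Rintegral_cst//.
  by apply: eq_Rintegral => x _; rewrite /stair big_ord0.
rewrite big_ord_recr/= -IH.
have mA := open_borel (level cf (N.+1%:R * h)).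
transitivity (\int[mu]_(x in setT)
    (stair f h N x + \1_[set x | N.+1%:R * h < f x] x)).
  by apply: eq_Rintegral => x _; rewrite /stair big_ord_recr.
rewrite RintegralD//; [|exact: stair_integrable|exact: integrable_indic].
congr (_ + _); rewrite /Rintegral.
by rewrite (integral_indic mu (measurableT : measurable [set: borel T]) mA) setIT.
Qed.

Lemma layer_sum_le mu f h N : continuous f ->
  mu.-integrable [set: borel T] (EFin \o f) -> 0 <= h -> (forall x, 0 <= f x) ->
  layer_sum (fun A => fine (mu A)) f h N <= Rintegral mu setT f.
Proof.
move=> cf fi h0 f0; rewrite -Rintegral_stair//; apply: le_Rintegral => //.
  apply: (integrableZl (measurableT : measurable [set: borel T]) h
    (@stair_integrable mu f h N cf)).
by move=> x _; exact: stair_lower.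
Qed.

Lemma layer_sum_ge mu f h N : continuous f ->
  mu.-integrable [set: borel T] (EFin \o f) -> 0 <= h ->
  (forall x, f x <= N.+1%:R * h) ->
  Rintegral mu setT f <= layer_sum (fun A => fine (mu A)) f h N + h.
Proof.
move=> cf fi h0 fN; rewrite -Rintegral_stair//.
have hi := integrableZl (measurableT : measurable [set: borel T]) h
    (@stair_integrable mu f h N cf).
have ci : mu.-integrable [set: borel T] (EFin \o cst h).
  by apply: (@bounded_integrable _ _ `|h|) => //; exact: measurable_cst.
apply: (@le_trans _ _ (Rintegral mu setT (fun x => h * stair f h N x + h))); last first.
  by rewrite (RintegralD _ hi ci)// Rintegral_cst_probability.
apply: le_Rintegral => //.
  by have := integrableD measurableT hi ci.
by move=> x _; exact: stair_upper.
Qed.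

Section ultra.
Context (I : Type) (U : set_system I) {FU : UltraFilter U}.
Variables (mu_ : I -> borel_probability T R) (mu : borel_probability T R).
Hypothesis dom : forall V : set T, open V ->
  (mu V <= (ulim U (fun i => fine (mu_ i V)))%:E)%E.

Let cvg_mu (A : set (borel T)) : measurable A ->
  fine (mu_ i A) @[i --> U] --> ulim U (fun i => fine (mu_ i A)).
Proof.
move=> mA; apply: (@cvg_ulim _ _ _ _ _ 0 1); apply: filterS filterT => i _.
by rewrite (fa_ge0 (fa_probability (mu_ i)) mA) (fa_le1 (fa_probability (mu_ i)) mA).
Qed.

Let cvg_layer f h N : continuous f ->
  layer_sum (fun A => fine (mu_ i A)) f h N @[i --> U] -->
  layer_sum (fun A => ulim U (fun i => fine (mu_ i A))) f h N.
Proof.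
move=> cf; apply: cvgMr; elim: N => [|N IH].
  rewrite big_ord0; apply: cvg_near_cst; apply: filterS filterT => i _.
  by rewrite big_ord0.
rewrite big_ord_recr/=; under eq_fun do rewrite big_ord_recr/=.
by apply: cvgD => //; apply: cvg_mu; apply: open_borel; exact: level.
Qed.

Let cvg_Rintegral f (B : R) : continuous f -> (forall x, `|f x| <= B) ->
  Rintegral (mu_ i) setT f @[i --> U] -->
  ulim U (fun i => Rintegral (mu_ i) setT f).
Proof.
move=> cf fB; apply: (@cvg_ulim _ _ _ _ _ (- B) B).
apply: filterS filterT => i _; rewrite -ler_norml.
have mf := continuous_borel_real cf.
have fi := @bounded_integrable (mu_ i) f B mf fB.
apply: le_trans (le_normr_Rintegral measurableT fi) _.
rewrite -(Rintegral_cst_probability (mu_ i) B).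
apply: le_Rintegral => //.
  apply: (@bounded_integrable _ (fun x => `|f x|) B) => [|x].
    exact: measurableT_comp.
  by rewrite normr_id.
by apply: (@bounded_integrable _ _ `|B|) => //; exact: measurable_cst.
Qed.

(** The layer sums with step [h] approximate integrals within [h] from below for
    all measures at once, and involve only measures of open sets, where
    domination applies. *)
Lemma Rintegral_le_ulim f (B : R) : continuous f ->
  (forall x, 0 <= f x <= B) ->
  Rintegral mu setT f <= ulim U (fun i => Rintegral (mu_ i) setT f).
Proof.
move=> cf fB; apply/ler_addgt0Pr => h h0.
have fB' x : `|f x| <= B by have /andP[f0 ?] := fB x; rewrite ger0_norm.
have [N BN] : exists N : nat, B <= N.+1%:R * h.
  exists (Num.truncn (B / h)); rewrite -ler_pdivrMr//.
  exact/ltW/truncnS_gt.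
have mf := continuous_borel_real cf.
apply: (@le_trans _ _ (layer_sum (fun A => fine (mu A)) f h N + h)).
  apply: layer_sum_ge => //; last 2 first.
  - exact: ltW.
  - by move=> x; have /andP[_ ?] := fB x; exact: le_trans BN.
  exact: bounded_integrable fB'.
rewrite lerD2r.
apply: (@le_trans _ _ (layer_sum (fun A => ulim U (fun i => fine (mu_ i A))) f h N)).
  apply: ler_wpM2l; first exact: ltW.
  apply: ler_sum => k _; rewrite -lee_fin fineK; last first.
    by apply: fin_num_measure; apply: open_borel; exact: level.
  by apply: dom; exact: level.
have cl := @cvg_layer f h N cf.
apply: (le_cvg_filter cl (cvg_Rintegral cf fB')).
apply: filterS filterT => i _; apply: layer_sum_le => //.
- exact: bounded_integrable fB'.
- exact: ltW.
- by move=> x; have /andP[] := fB x.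
Qed.

(** The one-sided estimate, made applicable to functions of any sign by adding
    the constant [B], holds for both [f] and its opposite. *)
Theorem portmanteau_Rintegral f (B : R) : continuous f ->
  (forall x, `|f x| <= B) ->
  Rintegral (mu_ i) setT f @[i --> U] --> Rintegral mu setT f.
Proof.
move=> cf fB; have cU := cvg_Rintegral cf fB.
suff -> : Rintegral mu setT f = ulim U (fun i => Rintegral (mu_ i) setT f) by [].
have shift (la : borel_probability T R) (s : R) g : continuous g ->
    (forall x, `|g x| <= B) ->
    Rintegral la setT (fun x => g x + B) = Rintegral la setT g + B.
  move=> cg gB; rewrite RintegralD//.
  - by rewrite Rintegral_cst_probability.
  - by apply: bounded_integrable gB; exact: continuous_borel_real.
  - by apply: (@bounded_integrable _ _ `|B|) => //; exact: measurable_cst.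
have le_ulim g : continuous g -> (forall x, `|g x| <= B) ->
    Rintegral mu setT g <= ulim U (fun i => Rintegral (mu_ i) setT g).
  move=> cg gB; rewrite -(lerD2r B) -(shift mu 0)//.
  have cgB : continuous (fun x => g x + B).
    by move=> x; apply: cvgD; [exact: cg|exact: cvg_cst].
  apply: le_trans (@Rintegral_le_ulim _ (B + B) cgB _) _.
    by move=> x; have := gB x; rewrite ler_norml => /andP[? ?]; apply/andP; split; lra.
  rewrite le_eqVlt; apply/orP; left; apply/eqP; apply: ulim_eq.
  under eq_fun do rewrite (shift _ 0)//.
  by apply: cvgD; [exact: cvg_Rintegral gB|exact: cvg_cst].
apply/eqP; rewrite eq_le le_ulim//=.
have cNf : continuous (fun x => - f x) by move=> x; apply: cvgN; exact: cf.
have NfB x : `|- f x| <= B by rewrite normrN.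
have NE (la : borel_probability T R) :
    Rintegral la setT (fun x => - f x) = - Rintegral la setT f.
  rewrite -mulN1r -RintegralZl//; last first.
    by apply: bounded_integrable fB; exact: continuous_borel_real.
  by apply: eq_Rintegral => x _; rewrite mulN1r.
have := le_ulim _ cNf NfB; rewrite NE lerNl; apply: le_trans.
rewrite le_eqVlt; apply/orP; left; apply/eqP.
rewrite -[LHS]opprK; congr (- _); apply/esym/ulim_eq.
by under eq_fun do rewrite NE; exact: cvgN.
Qed.

End ultra.

End portmanteau.

(** * Discrete orbits as paths over the rationals *)

(** The orbit is read with time step [1/N] and frozen between two steps. No
    regularity is lost in the limit, because only transitions between rationals
    that are multiples of [1/N] are ever used. *)
Definition step_path (T : Type) (N : nat) (u : orbit_space T) :
  rational_space T := fun q => u (Num.floor (q * N%:R)).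

Lemma orbit_eval_continuous (T : topologicalType) (i : int) :
  continuous (fun u : orbit_space T => u i).
Proof. exact: (@ptws_eval_continuous int T i). Qed.

Lemma step_path_continuous (T : topologicalType) (N : nat) :
  continuous (@step_path T N).
Proof.
apply: (@ptws_continuous rat (orbit_space T) T) => q.
exact: (@orbit_eval_continuous T (Num.floor (q * N%:R))).
Qed.

Lemma orbit_shift_continuous (R : realType) (M : metricType R) :
  continuous (@orbit_shift R M).
Proof.
apply: (@ptws_continuous int (orbit_space M) M) => i.
exact: (@orbit_eval_continuous M (i + 1)).
Qed.

Lemma iter_orbit_shift (R : realType) (M : metricType R) (k : nat)
    (u : orbit_space M) : iter k (@orbit_shift R M) u = fun i => u (i + k%:Z).
Proof.
elim: k => [|k IH] /=; first by apply/funext => i; rewrite addr0.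
by rewrite IH; apply/funext => i; rewrite /orbit_shift -addrA intS.
Qed.

Lemma step_path_shift (R : realType) (M : metricType R) (N k : nat) (r : rat)
    (u : orbit_space M) : r * N%:R = k%:R ->
  rational_shift r (step_path N u) = step_path N (iter k (@orbit_shift R M) u).
Proof.
move=> rN; rewrite iter_orbit_shift; apply/funext => q.
rewrite /rational_shift /step_path mulrDl rN addrC; congr (u _).
by rewrite -[k%:R]/(k%:Z%:~R) floorDrz ?intr_int// intrKfloor.
Qed.

Lemma factorial_clears_denominator (q : rat) :
  \forall n \near \oo, exists a : int, q * n`!%:R = a%:~R.
Proof.
exists `|denq q|%N => // n /= dn.
have d0 : (0 < `|denq q|)%N by rewrite absz_gt0 denq_neq0.
have /dvdnP[k ->] : (`|denq q| %| n`!)%N by rewrite dvdn_fact// d0.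
exists (numq q * k%:Z).
rewrite natrM mulrCA.
have -> : `|denq q|%N%:R = (denq q)%:~R :> rat by rewrite -{2}(gez0_abs (denq_ge0 q)).
by rewrite -{1}(divq_num_den q) mulfVK ?intr_eq0 ?denq_neq0// mulrC intrM.
Qed.

Section discretization.
Context (R : realType) (M : pmetricType R) (Phi : svds M).
Local Notation Q := (rational_space M).

Lemma orbit_iter (t : R) (u : int -> M) (i : int) (k : nat) : 0 <= t ->
  (forall j, (j < k)%N -> Phi t (u (i + j%:Z)) (u (i + j%:Z + 1))) ->
  Phi (k%:R * t) (u i) (u (i + k%:Z)).
Proof.
move=> t0; elim: k => [_|k IH H]; first by rewrite mul0r svds0 addr0.
rewrite -natr1 mulrDl mul1r addrC.
apply: (svds_comp (y := u (i + k%:Z))); rewrite ?mulr_ge0//.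
  by apply: IH => j jk; apply: H; rewrite ltnS ltnW.
by have := H k (ltnSn k); rewrite -addrA [k%:Z + 1]addrC -intS.
Qed.

Lemma step_path_transition (N : nat) (u : orbit_space M) (p q : rat)
    (a b : int) : (0 < N)%N -> p <= q -> p * N%:R = a%:~R -> q * N%:R = b%:~R ->
  (forall j : nat, Phi N%:R^-1 (u (a + j%:Z)) (u (a + j%:Z + 1))) ->
  transitions Phi p q (step_path N u).
Proof.
move=> N0 pq pa qb H.
have ab : a <= b by rewrite -(ler_int rat) -pa -qb ler_wpM2r.
have N0' : N%:R != 0 :> rat by rewrite pnatr_eq0 -lt0n.
have := @orbit_iter N%:R^-1 u a `|b - a|%N _ (fun j _ => H j).
rewrite /transitions/= /step_path pa qb !intrKfloor.
rewrite gez0_abs ?subr_ge0// subrKC.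
have -> : ratr (q - p) = `|b - a|%N%:R * N%:R^-1 :> R.
  have -> : q - p = (b - a)%:~R / N%:R.
    by rewrite intrB -pa -qb -mulrBl mulfK.
  rewrite fmorph_div /= ratr_nat ratr_int; congr (_ / _).
  by rewrite -[RHS]/(`|b - a|%N%:~R) gez0_abs// subr_ge0.
by apply; rewrite invr_ge0.
Qed.
End discretization.

(** * Equivalence of the two notions of invariance *)

Section invariant_measures_theory.
Context (R : realType) (M : pmetricType R) (Phi : svds M).
Hypothesis compactM : compact [set: M].
Local Notation P := (path_space M).
Local Notation Q := (rational_space M).
Local Notation O := (orbit_space M).

Lemma path_eval0_continuous : continuous (@path_eval0 R M).
Proof. exact: (@path_eval_continuous R M 0). Qed.

Lemma flow_invariant_of_finitely_additive (m : set Q -> R) :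
  finitely_additive m ->
  (forall p q, p <= q -> m (transitions Phi p q) = 1) ->
  (forall r (A : set (borel Q)), 0 <= r -> measurable A ->
    m (rational_shift r @^-1` A) = m A) ->
  exists mu : borel_probability M R, flow_invariant Phi mu /\
    forall V : set M, open V -> (mu V <= (m [set x | V (x 0)])%:E)%E.
Proof.
move=> mP mtr mshift.
have [nu [nuS nut nuV]] := invariant_lift compactM mP mtr mshift.
have [mu muE] := image_probability nu (continuous_borel path_eval0_continuous).
exists mu; split=> [|V oV]; last by rewrite muE; exact: nuV.
exists nu; split => //; last by move=> A mA; rewrite muE.
exists (~` solutions Phi); split => //; apply: open_borel.
by apply: closed_openC; exact: closed_solutions.
Qed.

Lemma closed_discrete_orbits t : 0 <= t -> closed (discrete_orbits Phi t).
Proof.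
move=> t0.
have -> : discrete_orbits Phi t = \bigcap_(i in [set: int])
   ((fun u : O => (u i, u (i + 1))) @^-1` [set p : M * M | Phi t p.1 p.2]).
  by rewrite eqEsubset; split=> [u uP i _|u uP i]; [exact: uP|exact: (uP i)].
apply: closed_bigI => i _.
pose ev (u : O) := (u i, u (i + 1)).
have cev : continuous ev.
  move=> u; apply: (@cvg_pair _ _ _ (nbhs u)).
    exact: (@orbit_eval_continuous M i u).
  exact: (@orbit_eval_continuous M (i + 1) u).
exact: ((continuous_closedP ev).1 cev _ (@closed_svds_graph R M Phi _ t0)).
Qed.

Definition sample (t : R) (y : P) : O := fun i => path_fun y (i%:~R * t).

Lemma sample_continuous t : continuous (sample t).
Proof.
apply: (@ptws_continuous int P M) => i.
exact: (@path_eval_continuous R M (i%:~R * t)).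
Qed.

Lemma sample_solution t y : 0 <= t -> solutions Phi y ->
  discrete_orbits Phi t (sample t y).
Proof.
move=> t0 yP i; have := yP (i%:~R * t) ((i + 1)%:~R * t).
rewrite intrD mulrDl mul1r lerDl t0 => /(_ isT).
by rewrite addrAC subrr add0r /sample intrD mulrDl mul1r.
Qed.

Lemma orbit_shift_sample t y : orbit_shift (sample t y) = sample t (translate t y).
Proof.
apply/funext => i; rewrite /orbit_shift /sample /path_fun /translate /=.
by rewrite /mkcts intrD mulrDl mul1r addrC.
Qed.

Theorem flow_discrete_invariant (mu : borel_probability M R) :
  flow_invariant Phi mu -> discrete_invariant Phi mu.
Proof.
move=> [nu [nuS nu0 nut]] t t0.
have [la laE] := image_probability nu (continuous_borel (@sample_continuous t)).
exists la; split=> [|A mA|A mA].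
- have oN : open (~` discrete_orbits Phi t).
    by apply: closed_openC; exact: closed_discrete_orbits.
  exists (~` discrete_orbits Phi t); split => //; first exact: open_borel.
  rewrite laE; apply: measure_negligible.
    by apply: preimage_borel (@sample_continuous t) _; exact: open_borel.
  by apply: negligibleS nuS => y nD yP; apply: nD; exact: sample_solution.
- rewrite -nu0// /pushforward laE; congr (nu _).
  by rewrite eqEsubset; split=> y; rewrite /= /orbit_eval0 /sample mul0r.
- rewrite !laE -[RHS](nut t); last exact: preimage_borel (@sample_continuous t) mA.
  by congr (nu _); rewrite eqEsubset; split=> y /=; rewrite orbit_shift_sample.
Qed.

Lemma iter_shift_invariant (nu : borel_probability O R) :
  (forall A : set (borel O), measurable A -> nu (@orbit_shift R M @^-1` A) = nu A) ->
  forall k (A : set (borel O)), measurable A ->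
    nu (iter k (@orbit_shift R M) @^-1` A) = nu A.
Proof.
move=> nus; elim=> [//|k IH] A mA.
have msA := preimage_borel (@orbit_shift_continuous R M) mA.
by rewrite -[RHS](nus _ mA) -[RHS](IH _ msA).
Qed.

(** Read as laws of step functions over the rationals, the discrete measures with
    steps [1/n!] satisfy the transition constraint and the invariance for given
    rationals as soon as [n!] clears their denominators; hence any ultralimit
    satisfies all of them. *)
Theorem discrete_flow_invariant (mu : borel_probability M R) :
  discrete_invariant Phi mu -> flow_invariant Phi mu.
Proof.
move=> muD.
have N0 n : 0 <= n`!%:R^-1 :> R by rewrite invr_ge0.
have /choice[nu_ nuP] (n : nat) := muD _ (N0 n).
have [U UU Uoo] := exists_ultrafilter_nat.
pose m_ n (A : set Q) : R := fine (nu_ n (step_path n`! @^-1` A)).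
have cstep n : continuous (@step_path M n) := @step_path_continuous M n.
have mP : finitely_additive (fun A => ulim U (fun n => m_ n A)).
  apply: fa_ulim; apply: filterS filterT => n _.
  have := @fa_preimage R O Q _ _ (continuous_borel (cstep n`!)) (fa_probability (nu_ n)).
  exact.
have [|r A r0 mA|mu' [mu'inv mu'V]] := flow_invariant_of_finitely_additive mP.
- move=> p q pq; apply: ulim_near; apply: Uoo.
  have pn := factorial_clears_denominator p.
  have qn := factorial_clears_denominator q.
  apply: filterS2 pn qn => n [a pa] [b qb]; rewrite /m_.
  have [nuN _ _] := nuP n.
  have ctr : closed (transitions Phi p q) by exact: closed_transitions.
  have mC : measurable (step_path n`! @^-1` (~` transitions Phi p q) : set (borel O)).
    apply: preimage_borel (cstep _) _.
    by apply: open_borel; exact: closed_openC.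
  have nC0 : nu_ n (step_path n`! @^-1` (~` transitions Phi p q)) = 0%E.
    apply: measure_negligible mC _; apply: negligibleS nuN => u nu uP; apply: nu.
    apply: step_path_transition pq pa qb _ => [|j]; first exact: fact_gt0.
    exact: uP.
  rewrite -(setCK (step_path _ @^-1` _)).
  rewrite (fa_setC (fa_probability (nu_ n)) mC).
  by rewrite nC0 subr0.
- apply: eq_ulim; apply: Uoo.
  apply: filterS (factorial_clears_denominator r) => n [a ra]; rewrite /m_.
  have a0 : 0 <= a by rewrite -(ler_int rat) -ra mulr_ge0.
  have {ra} ra : r * n`!%:R = `|a|%N%:R.
    by rewrite ra -{1}(gez0_abs a0).
  have [_ _ nus] := nuP n.
  rewrite -[in RHS](iter_shift_invariant nus `|a|); last exact: preimage_borel (cstep _) mA.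
  congr (fine (nu_ n _)); rewrite eqEsubset; split=> u /=;
    by rewrite (step_path_shift _ ra).
have mu'E : forall A, measurable A -> mu' A = mu A.
  apply: open_dominated_eq => V oV; apply: le_trans (mu'V V oV) _.
  rewrite (ulim_near (c := fine (mu V))).
    by rewrite fineK// fin_num_measure//; exact: open_borel.
  apply: filterS filterT => n _; have [_ nu0 _] := nuP n.
  rewrite /m_ -nu0; last exact: open_borel.
  congr (fine (nu_ n _)); rewrite eqEsubset; split=> u;
    by rewrite /= /step_path mul0r floor0.
have [nu [nuS nu0 nut]] := mu'inv.
by exists nu; split => // A mA; rewrite nu0// mu'E.
Qed.

End invariant_measures_theory.

(** * Existence, compactness and convexity *)

(** Each unit shift of the window trades one term of the unit interval for
    another. *)
Lemma sum_shift_le (R : realType) (a : nat -> R) (N c : nat) :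
  (forall k, 0 <= a k <= 1) ->
  `|\sum_(k < N) a (k + c)%N - \sum_(k < N) a k| <= c%:R.
Proof.
move=> a01; elim: c => [|c IH].
  by under eq_bigr do rewrite addn0; rewrite subrr normr0.
have step : `|\sum_(k < N) a (k + c.+1)%N - \sum_(k < N) a (k + c)%N| <= 1.
  rewrite -sumrB -(big_mkord xpredT (fun k => a (k + c.+1)%N - a (k + c)%N)).
  under eq_bigr do rewrite addnS -addSn.
  rewrite (telescope_sumr (fun k => a (k + c)%N))// add0n ler_norml.
  by have := a01 (N + c)%N; have := a01 c; lra.
rewrite -natr1 [leRHS]addrC; apply: le_trans (lerD step IH).
by rewrite (le_trans _ (ler_normD _ _))// addrA subrK.
Qed.

Section existence_compactness_convexity.
Context (R : realType) (M : pmetricType R) (Phi : svds M).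
Hypothesis compactM : compact [set: M].
Local Notation P := (path_space M).
Local Notation Q := (rational_space M).
Local Notation O := (orbit_space M).

(** Empirical averages along step functions drawn from a forward orbit with step
    [1/n!]. The averaging window has [n + 1] units of time, so that a translation
    by [r] changes averages by at most [r / (n + 1)]; it starts after [n + 1]
    units of time, so that the values at a given rational, even negative, lie
    eventually on the forward part of the orbit. *)
Theorem exists_flow_invariant :
  exists mu : borel_probability M R, flow_invariant Phi mu.
Proof.
have N0 n : 0 <= n`!%:R^-1 :> R by rewrite invr_ge0.
have /choice[g gP] (n : nat) : exists g : M -> M, forall x, Phi n`!%:R^-1 x (g x).
  have /choice[g gP] x : exists y, Phi n`!%:R^-1 x y by exact: svds_nonempty.
  by exists g.
pose u n : O := fun i : int => iter `|i|%N (g n) point.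
pose L n := (n.+1 * n`!)%N.
have L0 n : (0 < L n)%N by rewrite muln_gt0 fact_gt0.
pose x n k : Q := step_path n`! (iter (L n + k) (@orbit_shift R M) (u n)).
pose m_ n (A : set Q) : R := (L n)%:R^-1 * \sum_(k < L n) \1_A (x n k).
have [U UU Uoo] := exists_ultrafilter_nat.
have m_P n : finitely_additive (m_ n) by exact: fa_count.
have mP : finitely_additive (fun A => ulim U (fun n => m_ n A)).
  by apply: fa_ulim; apply: filterS filterT => n _.
have [|r A r0 mA|mu [mu'inv _]] := flow_invariant_of_finitely_additive compactM mP (Phi := Phi).
- move=> p q pq; apply: ulim_near; apply: Uoo.
  have pn := factorial_clears_denominator p.
  have qn := factorial_clears_denominator q.
  have np : \forall n \near \oo, - p < n%:R.
    exists (Num.truncn (- p)).+1 => // n /= pn'.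
    by apply: lt_le_trans (truncnS_gt _) _; rewrite ler_nat.
  apply: filterS3 pn qn np => n [a pa] [b qb] pn; rewrite /m_.
  rewrite (eq_bigr (fun=> 1)) => [|k _].
    by rewrite sumr_const card_ord mulVf// pnatr_eq0 -lt0n.
  rewrite indicE mem_set//.
  apply: (step_path_transition _ pq pa qb) => [|j]; first exact: fact_gt0.
  have aL : 0 <= a + j%:Z + (L n + k)%N%:Z.
    have : - a%:~R <= (L n)%:R :> rat.
      rewrite -pa -mulNr /L natrM ler_wpM2r// (le_trans (ltW pn))//.
      by rewrite ler_nat.
    by rewrite -[(L n)%:R]/((L n)%:Z%:~R) -intrN ler_int; lia.
  rewrite !iter_orbit_shift [X in Phi _ _ (_ X)]addrAC.
  move: aL; case: (a + _ + _) => // i _.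
  have -> : i%:Z + 1 = i.+1%:Z by rewrite addrC -intS.
  exact: gP.
- pose a n k : R := \1_A (x n k).
  apply: (@ulim_asymptotic _ _ U _ _ _ 0 1).
    apply: filterS filterT => n _.
    by rewrite (fa_ge0 (m_P n) mA) (fa_le1 (m_P n) mA).
  apply/cvgr0Pnorm_le => e e0; apply: Uoo.
  have rn : \forall n \near \oo, ratr r / e <= n.+1%:R :> R.
    exists (Num.truncn (ratr r / e : R)) => // n /= rn.
    by apply: le_trans (ltW (truncnS_gt _)) _; rewrite ler_nat ltnS.
  apply: filterS2 (factorial_clears_denominator r) rn => n [b rb] rn.
  have b0 : 0 <= b by rewrite -(ler_int rat) -rb mulr_ge0.
  have {rb} rb : r * n`!%:R = `|b|%N%:R by rewrite rb -{1}(gez0_abs b0).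
  have L0' : 0 < (L n)%:R :> R by rewrite ltr0n.
  rewrite /m_ -mulrBr normrM ger0_norm ?invr_ge0// mulrC ler_pdivrMr//.
  have -> : \sum_(k < L n) \1_(rational_shift r @^-1` A) (x n k) =
      \sum_(k < L n) a n (k + `|b|)%N.
    apply: eq_bigr => k _; rewrite /a !indicE; congr (nat_of_bool _)%:R.
    have xE : rational_shift r (x n k) = x n (k + `|b|)%N.
      by rewrite /x (step_path_shift _ rb) -iterD addnC addnA.
    by rewrite -xE; apply/idP/idP => /set_mem Ax; exact/mem_set.
  apply: le_trans (sum_shift_le (a := a n) (L n) `|b| _) _.
    by move=> k; rewrite /a indicE; case: (_ \in _); rewrite ?lexx ler01.
  have -> : `|b|%N%:R = ratr r * n`!%:R :> R by rewrite -ratr_nat -rmorphM rb /= ratr_nat.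
  rewrite /L natrM mulrA ler_wpM2r// mulrC.
  by rewrite -ler_pdivrMr.
- by exists mu.
Qed.

Definition rational_restriction (y : P) : Q := fun q => path_fun y (ratr q).

Lemma rational_restriction_continuous : continuous rational_restriction.
Proof.
apply: (@ptws_continuous rat P M) => q.
exact: (@path_eval_continuous R M (ratr q)).
Qed.

(** The conditional statement lets one choose such an [m] for all [mu]
    simultaneously, invariant or not. *)
Lemma flow_invariant_finitely_additive (mu : borel_probability M R) :
  exists m : set Q -> R, flow_invariant Phi mu ->
  [/\ finitely_additive m,
      forall p q, p <= q -> m (transitions Phi p q) = 1,
      forall r (A : set (borel Q)), measurable A ->
        m (rational_shift r @^-1` A) = m A
    & forall V : set M, open V -> m [set x | V (x 0)] = fine (mu V)].
Proof.
have [[nu [nuS nu0 nut]]|nmu] := pselect (flow_invariant Phi mu); last first.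
  by exists (fun=> 0).
have cr := rational_restriction_continuous.
exists (fun A => fine (nu (rational_restriction @^-1` A))) => _; split.
- by have := fa_preimage (continuous_borel cr) (fa_probability nu); exact.
- move=> p q pq.
  have ctr : closed (transitions Phi p q) by exact: closed_transitions.
  have mC : measurable (rational_restriction @^-1` (~` transitions Phi p q) : set (borel P)).
    apply: (preimage_borel cr).
    by apply: open_borel; exact: closed_openC.
  have nC0 : nu (rational_restriction @^-1` (~` transitions Phi p q)) = 0%E.
    apply: (measure_negligible mC); apply: negligibleS nuS => y ny yP; apply: ny.
    exact: solutions_rational pq.
  rewrite -(setCK (rational_restriction @^-1` _)).
  by rewrite (fa_setC (fa_probability nu) mC) nC0 subr0.
- move=> r A mA; rewrite -[in RHS](nut (ratr r)); last exact: (preimage_borel cr).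
  congr (fine (nu _)).
  have rE y : rational_shift r (rational_restriction y) =
      rational_restriction (translate (ratr r) y).
    apply/funext => q; rewrite /rational_shift /rational_restriction rmorphD.
    by rewrite /path_fun /translate /=.
  by rewrite eqEsubset; split=> y /=; rewrite rE.
- move=> V oV; rewrite -nu0; last exact: open_borel.
  congr (fine (nu _)).
  by rewrite eqEsubset; split=> y /=; rewrite /rational_restriction rmorph0.
Qed.

(** The limit of an ultrafilter of invariant measures is built from the laws of
    paths that witness their invariance, so that it is invariant by
    construction. *)
Theorem compact_invariant_measures :
  @compact (weak_star R M) (invariant_measures Phi).
Proof.
rewrite compact_ultra => F FU Finv.
have /choice[m_ m_P] := flow_invariant_finitely_additive.
pose m A := ulim F (fun mu => m_ mu A).
have mP : finitely_additive m.
  by apply: fa_ulim; apply: filterS Finv => mu /m_P[].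
have [|r A _ mA|mu [mu_inv muV]] := flow_invariant_of_finitely_additive compactM mP (Phi := Phi).
- by move=> p q pq; apply: ulim_near; apply: filterS Finv => mu /m_P[_ + _ _]; exact.
- by apply: eq_ulim; apply: filterS Finv => mu /m_P[_ _ + _]; exact.
exists mu; split; first exact: mu_inv.
pose I (la : weak_star R M) : {ptws continuousType M R -> R} :=
  fun f => Rintegral (la : borel_probability M R) setT f.
have IF : I @ F --> I mu.
  apply: (@ptws_cvg (continuousType M R) R (I @ F)) => f.
  have cf : continuous f by exact: cts_fun.
  have [B [_ fB]] : bounded_set (f @` [set: M]).
    apply: (@compact_bounded R R^o); apply: continuous_compact => //.
    exact: continuous_subspaceT.
  have fB1 x : `|f x| <= B + 1 by apply: (fB (B + 1)); [rewrite ltrDl|exists x].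
  apply: (@portmanteau_Rintegral R M _ F FU id mu _ f (B + 1) cf fB1) => V oV.
  apply: le_trans (muV V oV) _; rewrite lee_fin le_eqVlt; apply/orP; left.
  apply/eqP; apply: eq_ulim.
  by apply: filterS Finv => la /m_P[_ _ _]; exact.
move=> A; rewrite nbhsE => -[_ [[C oC <-] Cmu] CA].
have FC : F (I @^-1` C) by apply: IF; exact: open_nbhs_nbhs.
by apply: filterS FC => la Cla; exact: CA.
Qed.

Theorem convex_invariant_measures :
  convex_probabilities (invariant_measures Phi).
Proof.
move=> p mu1 mu2 [nu1 [nuS1 nu01 nut1]] [nu2 [nuS2 nu02 nut2]].
have mS : measurable (~` solutions Phi : set (borel P)).
  by apply: open_borel; apply: closed_openC; exact: closed_solutions.
exists (mixture p nu1 nu2); split.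
- exists (~` solutions Phi); split => //.
  rewrite /= /mixture (measure_negligible mS nuS1) (measure_negligible mS nuS2).
  by rewrite !mule0 adde0.
- move=> A mA; rewrite /pushforward /= /mixture.
  by congr (_ * _ + _ * _)%E; [exact: nu01|exact: nu02].
- by move=> t A mA; rewrite /= /mixture nut1// nut2.
Qed.

End existence_compactness_convexity.

Unset Implicit Arguments.

Theorem theorem2p6 (R : realType) (M : pmetricType R)
    (compactM : compact [set: M]) (Phi : svds M) :
  (forall mu : borel_probability M R,
     discrete_invariant Phi mu <-> flow_invariant Phi mu) /\
  [/\ invariant_measures Phi !=set0,
      @compact (weak_star R M) (invariant_measures Phi)
    & convex_probabilities (invariant_measures Phi)].
Proof.
split=> [mu|]; first split.
- exact: discrete_flow_invariant.
- exact: flow_discrete_invariant.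
split.
- exact: exists_flow_invariant.
- exact: compact_invariant_measures.
- exact: convex_invariant_measures.
Qed.
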